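(* Every cyclic, conjugative $*$-autonomous category is also a $\dagger$-$*$-autonomous category; that is, if $\mathbb{X}$ is a conjugative cyclic $*$-autonomous category, then $\mathbb{X}$ admits a dagger making it a $\dagger$-LDC (which is $*$-autonomous).
   Context: Composition is written in diagrammatic order ($fg$ means first $f$, then $g$). A linearly distributive category (LDC, in the sense of Cockett--Seely) is a category $\mathbb{X}$ with two monoidal structures $(\otimes,\top,a_\otimes,u_\otimes^L,u_\otimes^R)$ and $(\oplus,\bot,a_\oplus,u_\oplus^L,u_\oplus^R)$ and natural transformations $\partial^L:A\otimes(B\oplus C)\to(A\otimes B)\oplus C$, $\partial^R:(B\oplus C)\otimes A\to B\oplus(C\otimes A)$ satisfying the standard coherence conditions with the associators and unitors; here $a:(AB)C\to A(BC)$, $u^L_\otimes:\top\otimes A\to A$, $u^R_\otimes:A\otimes\top\to A$, and likewise for $\oplus$. **Duals.** A linear dual $(\eta,\epsilon):B\dashv\!\!\!\dashv A$ ($B$ is left dual to $A$, $A$ is right dual to $B$) consists of $\eta:\top\to B\oplus A$, $\epsilon:A\otimes B\to\bot$ with $(u^L_\otimes)^{-1}(\eta\otimes1)\partial^R(1\oplus\epsilon)u^R_\oplus=1_B$ and $(u^R_\otimes)^{-1}(1\otimes\eta)\partial^L(\epsilon\oplus1)u^L_\oplus=1_A$. Any two left (right) duals of an object are canonically isomorphic: for $(\eta,\epsilon):B\dashv\!\!\!\dashv A$ and $(\eta',\epsilon'):C\dashv\!\!\!\dashv A$ the isomorphism $B\to C$ is $(u^L_\otimes)^{-1}(\eta'\otimes1)\partial^R(1\oplus\epsilon)u^R_\oplus$;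 similarly for right duals. An LDC is $*$-autonomous if every object $A$ has a chosen left dual $A^*\dashv\!\!\!\dashv A$ and a chosen right dual $A\dashv\!\!\!\dashv{}^*\!A$; $(\_)^*$ and ${}^*(\_)$ are then contravariant functors. **Cyclor.** A cyclor on a $*$-autonomous category is a natural isomorphism $\psi_A:A^*\to{}^*\!A$ compatible with the canonical isomorphisms: (C.1) $\psi_\bot$ commutes with the canonical isomorphisms $\bot^*\cong\top\cong{}^*\bot$; (C.2) $\eta_A(\psi_A)^*\psi_{A^*}=\eta'_A$ where $\eta_A:A\to({}^*\!A)^*$ and $\eta'_A:A\to{}^*(A^* )$ are the canonical isomorphisms; (C.3) $\psi_\top$ commutes with $\top^*\cong\bot\cong{}^*\top$; (C.4) $\psi_{A\otimes B}$ corresponds to $\psi_B\oplus\psi_A$ under $(A\otimes B)^*\cong B^*\oplus A^*$, ${}^*(A\otimes B)\cong{}^*\!B\oplus{}^*\!A$; (C.5) $\psi_{A\oplus B}$ corresponds to $\psi_B\otimes\psi_A$ under $(A\oplus B)^*\cong B^*\otimes A^*$, ${}^*(A\oplus B)\cong{}^*\!B\otimes{}^*\!A$. **Conjugation.** A conjugative LDC is an LDC with a (covariant) functor $\overline{(\_)}:\mathbb{X}\to\mathbb{X}$ and natural isomorphisms $\chi_\otimes:\overline A\otimes\overline B\to\overline{B\otimes A}$, $\chi_\oplus:\overline{A\oplus B}\to\overline B\oplus\overline A$, $\varepsilon_A:\overline{\overline A}\to A$ such that $\overline{\varepsilon_A}=\varepsilon_{\overline A}$; $a_\otimes(1\otimes\chi_\otimes)\chi_\otimes=(\chi_\otimes\otimes1)\chi_\otimes\overline{a_\otimes^{-1}}$;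 $\chi_\otimes\overline{\chi_\otimes}\varepsilon=\varepsilon\otimes\varepsilon$; the same two equations hold with $(\oplus,\chi_\oplus^{-1})$ in place of $(\otimes,\chi_\otimes)$; and $(\chi_\oplus\otimes1)\partial^R(1\oplus\chi_\otimes)=\chi_\otimes\overline{\partial^L}\chi_\oplus:\overline{B\oplus C}\otimes\overline A\to\overline C\oplus\overline{A\otimes B}$, $(1\otimes\chi_\oplus)\partial^L(\chi_\otimes\oplus1)=\chi_\otimes\overline{\partial^R}\chi_\oplus:\overline A\otimes\overline{C\oplus B}\to\overline{B\otimes A}\oplus\overline C$. There are then unique isomorphisms $\chi^\circ_\top:\top\to\overline\top$, $\chi^\circ_\bot:\bot\to\overline\bot$ compatible with the unitors (e.g. $(\chi^\circ_\top\otimes1)\chi_\otimes=u^L_\otimes\overline{(u^R_\otimes)^{-1}}:\top\otimes\overline A\to\overline{A\otimes\top}$). If $(\eta,\epsilon):B\dashv\!\!\!\dashv A$ then $(\chi^\circ_\top\overline\eta\chi_\oplus,\ \chi_\otimes\overline\epsilon(\chi^\circ_\bot)^{-1}):\overline A\dashv\!\!\!\dashv\overline B$; hence $\overline{{}^*\!A}$ is a left dual and $\overline{A^*}$ a right dual of $\overline A$. A conjugative cyclic $*$-autonomous category is a conjugative LDC which is $*$-autonomous and has a cyclor $\psi$ such that $(\overline A)^*\xrightarrow{\psi_{\overline A}}{}^*(\overline A)\cong\overline{A^*}$ equals $(\overline A)^*\cong\overline{{}^*\!A}\xrightarrow{\overline{\psi_A^{-1}}}\overline{A^*}$, with the canonical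 isomorphisms of duals. **Dagger.** A $\dagger$-LDC is an LDC with a functor $(\_)^\dagger:\mathbb{X}^{op}\to\mathbb{X}$ and natural isomorphisms $\lambda_\otimes:A^\dagger\otimes B^\dagger\to(A\oplus B)^\dagger$, $\lambda_\oplus:A^\dagger\oplus B^\dagger\to(A\otimes B)^\dagger$, $\lambda_\top:\top\to\bot^\dagger$, $\lambda_\bot:\bot\to\top^\dagger$, $\iota:A\to A^{\dagger\dagger}$ such that (1) $(1\otimes\lambda_\otimes)\lambda_\otimes a_\oplus^\dagger=a_\otimes^{-1}(\lambda_\otimes\otimes1)\lambda_\otimes$ and $(1\oplus\lambda_\oplus)\lambda_\oplus a_\otimes^\dagger=a_\oplus^{-1}(\lambda_\oplus\oplus1)\lambda_\oplus$; (2) $(\lambda_\top\otimes1)\lambda_\otimes=u^L_\otimes(u^L_\oplus)^\dagger$, $(1\otimes\lambda_\top)\lambda_\otimes=u^R_\otimes(u^R_\oplus)^\dagger$, $(\lambda_\bot\oplus1)\lambda_\oplus=u^L_\oplus(u^L_\otimes)^\dagger$, $(1\oplus\lambda_\bot)\lambda_\oplus=u^R_\oplus(u^R_\otimes)^\dagger$; (3) $\partial^L(\lambda_\otimes\oplus1)\lambda_\oplus=(1\otimes\lambda_\oplus)\lambda_\otimes(\partial^R)^\dagger$ and $\partial^R(1\oplus\lambda_\otimes)\lambda_\oplus=(\lambda_\oplus\otimes1)\lambda_\otimes(\partial^L)^\dagger$; (4) $\iota\lambda_\otimes^\dagger=(\iota\oplus\iota)\lambda_\oplus$ and $\iota\lambda_\oplus^\dagger=(\iota\otimes\iota)\lambda_\otimes$;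 (5) $\iota_\bot\lambda_\top^\dagger=\lambda_\bot$ and $\iota_\top\lambda_\bot^\dagger=\lambda_\top$; (6) $\iota_{A^\dagger}=(\iota_A^{-1})^\dagger$. A $\dagger$-$*$-autonomous category is a $\dagger$-LDC that is $*$-autonomous. *)

(* Defs.v *)
(* Composition is in diagrammatic order: [f ≫ g] is first [f], then [g]. *)
From Corelib Require Import ssreflect ssrfun ssrbool.

Set Implicit Arguments.
Unset Strict Implicit.
Unset Printing Implicit Defensive.

Declare Scope cat_scope.
Delimit Scope cat_scope with cat.
Local Open Scope cat_scope.

Reserved Notation "f ≫ g" (at level 55, right associativity).
Reserved Notation "A ⊗ B" (at level 40, left associativity).
Reserved Notation "A ⊕ B" (at level 40, left associativity).
Reserved Notation "f ⊗₁ g" (at level 40, left associativity).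
Reserved Notation "f ⊕₁ g" (at level 40, left associativity).
Reserved Notation "f '^-1'" (at level 1, left associativity, format "f ^-1").

Record category := Category {
  ob :> Type;
  hom : ob -> ob -> Type;
  idm : forall A, hom A A;
  comp : forall A B C, hom A B -> hom B C -> hom A C;
  comp_idl : forall A B (f : hom A B), comp (idm A) f = f;
  comp_idr : forall A B (f : hom A B), comp f (idm B) = f;
  comp_assoc : forall A B C D (f : hom A B) (g : hom B C) (h : hom C D),
    comp (comp f g) h = comp f (comp g h)
}.
Arguments hom {c} A B.
Arguments idm {c} A.
Arguments comp {c A B C} f g.
Notation "f ≫ g" := (comp f g) : cat_scope.

Definition op (C : category) : category :=
  @Category C (fun A B => @hom C B A) (@idm C)
    (fun _ _ _ f g => g ≫ f)
    (fun _ _ f => comp_idr f) (fun _ _ f => comp_idl f)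
    (fun _ _ _ _ f g h => esym (comp_assoc h g f)).

Record iso (C : category) (A B : C) := Iso {
  iso_mor :> hom A B;
  iso_inv : hom B A;
  iso_morK : iso_mor ≫ iso_inv = idm A;
  iso_invK : iso_inv ≫ iso_mor = idm B
}.
Notation "f ^-1" := (iso_inv f) : cat_scope.

Definition iso_sym (C : category) (A B : C) (f : iso A B) : iso B A :=
  Iso (iso_invK f) (iso_morK f).

Record functor (C D : category) := Functor {
  fob :> C -> D;
  fmap : forall A B : C, hom A B -> hom (fob A) (fob B);
  fmap_id : forall A, fmap (idm A) = idm (fob A);
  fmap_comp : forall A B E (f : hom A B) (g : hom B E),
    fmap (f ≫ g) = fmap f ≫ fmap g
}.
Arguments fmap {C D} f {A B} _ : rename.

Record monoidal (C : category) := Monoidal {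
  mob : C -> C -> C;
  mmap : forall A B A' B', hom A A' -> hom B B' -> hom (mob A B) (mob A' B');
  munit : C;
  massoc : forall A B D, iso (mob (mob A B) D) (mob A (mob B D));
  mlunit : forall A, iso (mob munit A) A;
  mrunit : forall A, iso (mob A munit) A;
  mmap_id : forall A B, mmap (idm A) (idm B) = idm (mob A B);
  mmap_comp : forall A B A' B' A'' B''
    (f : hom A A') (f' : hom A' A'') (g : hom B B') (g' : hom B' B''),
    mmap (f ≫ f') (g ≫ g') = mmap f g ≫ mmap f' g';
  massoc_nat : forall A B D A' B' D' (f : hom A A') (g : hom B B') (h : hom D D'),
    mmap (mmap f g) h ≫ massoc A' B' D' = massoc A B D ≫ mmap f (mmap g h);
  mlunit_nat : forall A B (f : hom A B),
    mmap (idm munit) f ≫ mlunit B = mlunit A ≫ f;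
  mrunit_nat : forall A B (f : hom A B),
    mmap f (idm munit) ≫ mrunit B = mrunit A ≫ f;
  mpentagon : forall A B D E,
    mmap (massoc A B D) (idm E) ≫ massoc A (mob B D) E ≫ mmap (idm A) (massoc B D E)
    = massoc (mob A B) D E ≫ massoc A B (mob D E);
  mtriangle : forall A B,
    massoc A munit B ≫ mmap (idm A) (mlunit B) = mmap (mrunit A) (idm B)
}.
Arguments mmap {C} m {A B A' B'} f g : rename.
Arguments munit {C} m : rename.

Record LDC_data := LDCData {
  ldc_cat :> category;
  tensor : monoidal ldc_cat;
  par : monoidal ldc_cat
}.
Arguments tensor {l}.
Arguments par {l}.

Notation "A ⊗ B" := (mob tensor A B) : cat_scope.
Notation "A ⊕ B" := (mob par A B) : cat_scope.
Notation "f ⊗₁ g" := (mmap tensor f g) : cat_scope.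
Notation "f ⊕₁ g" := (mmap par f g) : cat_scope.
Notation "⊤" := (munit tensor) : cat_scope.
Notation "⊥" := (munit par) : cat_scope.
Notation aT := (massoc tensor).
Notation uLT := (mlunit tensor).
Notation uRT := (mrunit tensor).
Notation aP := (massoc par).
Notation uLP := (mlunit par).
Notation uRP := (mrunit par).
Notation "𝟙" := (idm _) : cat_scope.

(* The (non-symmetric) coherence conditions of Cockett and Seely. *)
Record LDC := MkLDC {
  ldc_data :> LDC_data;
  dL : forall A B C : ldc_data, hom (A ⊗ (B ⊕ C)) ((A ⊗ B) ⊕ C);
  dR : forall A B C : ldc_data, hom ((B ⊕ C) ⊗ A) (B ⊕ (C ⊗ A));
  dL_nat : forall (A B C A' B' C' : ldc_data)
    (f : hom A A') (g : hom B B') (h : hom C C'),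
    f ⊗₁ (g ⊕₁ h) ≫ dL A' B' C' = dL A B C ≫ (f ⊗₁ g) ⊕₁ h;
  dR_nat : forall (A B C A' B' C' : ldc_data)
    (f : hom A A') (g : hom B B') (h : hom C C'),
    (g ⊕₁ h) ⊗₁ f ≫ dR A' B' C' = dR A B C ≫ g ⊕₁ (h ⊗₁ f);
  dL_uLT : forall B C : ldc_data, dL ⊤ B C ≫ uLT B ⊕₁ 𝟙 = uLT (B ⊕ C);
  dR_uRT : forall B C : ldc_data, dR ⊤ B C ≫ 𝟙 ⊕₁ uRT C = uRT (B ⊕ C);
  dL_uRP : forall A B : ldc_data, dL A B ⊥ ≫ uRP (A ⊗ B) = 𝟙 ⊗₁ uRP B;
  dR_uLP : forall A C : ldc_data, dR A ⊥ C ≫ uLP (C ⊗ A) = uLP C ⊗₁ 𝟙;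
  dL_aT : forall A B C D : ldc_data,
    aT A B (C ⊕ D) ≫ 𝟙 ⊗₁ dL B C D ≫ dL A (B ⊗ C) D
    = dL (A ⊗ B) C D ≫ aT A B C ⊕₁ 𝟙;
  dL_aP : forall A B C D : ldc_data,
    𝟙 ⊗₁ aP B C D ≫ dL A B (C ⊕ D)
    = dL A (B ⊕ C) D ≫ dL A B C ⊕₁ 𝟙 ≫ aP (A ⊗ B) C D;
  dR_aT : forall A B C D : ldc_data,
    aT (B ⊕ C) A D ≫ dR (A ⊗ D) B C
    = dR A B C ⊗₁ 𝟙 ≫ dR D B (C ⊗ A) ≫ 𝟙 ⊕₁ aT C A D;
  dR_aP : forall A B C D : ldc_data,
    aP B C D ⊗₁ 𝟙 ≫ dR A B (C ⊕ D) ≫ 𝟙 ⊕₁ dR A C D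
    = dR A (B ⊕ C) D ≫ aP B C (D ⊗ A);
  dLR_aT : forall A B C D : ldc_data,
    aT A (B ⊕ C) D ≫ 𝟙 ⊗₁ dR D B C ≫ dL A B (C ⊗ D)
    = dL A B C ⊗₁ 𝟙 ≫ dR D (A ⊗ B) C;
  dLR_aP : forall A B C D : ldc_data,
    dL (A ⊕ B) C D ≫ dR C A B ⊕₁ 𝟙 ≫ aP A (B ⊗ C) D
    = dR (C ⊕ D) A B ≫ 𝟙 ⊕₁ dL B C D
}.
Arguments dL {l} A B C : rename.
Arguments dR {l} A B C : rename.

(* [linear_dual B A] is (η,ε) : B ⊣⊣ A : [B] is left dual to [A]. *)
Record linear_dual (X : LDC) (B A : X) := LinearDual {
  eta : hom ⊤ (B ⊕ A);
  eps : hom (A ⊗ B) ⊥;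
  dual_zigzag_left :
    (uLT B)^-1 ≫ eta ⊗₁ 𝟙 ≫ dR B B A ≫ 𝟙 ⊕₁ eps ≫ uRP B = idm B;
  dual_zigzag_right :
    (uRT A)^-1 ≫ 𝟙 ⊗₁ eta ≫ dL A B A ≫ eps ⊕₁ 𝟙 ≫ uLP A = idm A
}.

Lemma ra (C : category) (A B D E : C) (f : hom A B) (g : hom B D) (r : hom A D)
  (e : f ≫ g = r) (k : hom D E) : f ≫ g ≫ k = r ≫ k.
Proof. by rewrite -e comp_assoc. Qed.

Lemma ra3 (C : category) (A B B' D E : C) (f : hom A B) (g : hom B B')
  (h : hom B' D) (r : hom A D)
  (e : f ≫ g ≫ h = r) (k : hom D E) : f ≫ g ≫ h ≫ k = r ≫ k.
Proof. by rewrite -e !comp_assoc. Qed.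

Lemma iso_epi (C : category) (A B D : C) (i : iso A B) (f g : hom B D) :
  i ≫ f = i ≫ g -> f = g.
Proof.
move=> e; rewrite -(comp_idl f) -(comp_idl g) -(iso_invK i).
by rewrite !comp_assoc e.
Qed.

Lemma iso_mono (C : category) (A B D : C) (i : iso A B) (f g : hom D A) :
  f ≫ i = g ≫ i -> f = g.
Proof.
move=> e; rewrite -(comp_idr f) -(comp_idr g) -(iso_morK i).
by rewrite -!comp_assoc e.
Qed.

Lemma iso_swapl (C : category) (A B A' B' : C) (i : iso A B) (j : iso A' B')
  (f : hom A A') (g : hom B B') : i ≫ g = f ≫ j -> i^-1 ≫ f = g ≫ j^-1.
Proof.
move=> e; apply: (iso_epi (i := i)).
rewrite (ra (iso_morK i)) comp_idl (ra e) comp_assoc.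
by rewrite iso_morK comp_idr.
Qed.

Section MonoidalFacts.
Variables (C : category) (M : monoidal C).
Local Notation "A • B" := (mob M A B) (at level 40, left associativity).
Local Notation "f •₁ g" := (mmap M f g) (at level 40, left associativity).
Local Notation I := (munit M).
Local Notation a := (massoc M).
Local Notation uL := (mlunit M).
Local Notation uR := (mrunit M).

Lemma mmap_compl (A A' A'' B : C) (f : hom A A') (g : hom A' A'') :
  (f ≫ g) •₁ idm B = f •₁ 𝟙 ≫ g •₁ 𝟙.
Proof. by rewrite -mmap_comp comp_idl. Qed.

Lemma mmap_compr (A A' A'' B : C) (f : hom A A') (g : hom A' A'') :
  idm B •₁ (f ≫ g) = 𝟙 •₁ f ≫ 𝟙 •₁ g.
Proof. by rewrite -mmap_comp comp_idl. Qed.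

Lemma mmap_swap (A A' B B' : C) (f : hom A A') (g : hom B B') :
  𝟙 •₁ g ≫ f •₁ 𝟙 = f •₁ 𝟙 ≫ 𝟙 •₁ g.
Proof. by rewrite -!mmap_comp !comp_idl !comp_idr. Qed.

Lemma massoc_inv_nat A B D A' B' D' (f : hom A A') (g : hom B B') (h : hom D D') :
  (a A B D)^-1 ≫ (f •₁ g) •₁ h = f •₁ (g •₁ h) ≫ (a A' B' D')^-1.
Proof. by apply: iso_swapl; rewrite massoc_nat. Qed.

Lemma mlunit_inv_nat A B (f : hom A B) :
  (uL A)^-1 ≫ 𝟙 •₁ f = f ≫ (uL B)^-1.
Proof. by apply: iso_swapl; rewrite mlunit_nat. Qed.

Lemma mrunit_inv_nat A B (f : hom A B) :
  (uR A)^-1 ≫ f •₁ 𝟙 = f ≫ (uR B)^-1.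
Proof. by apply: iso_swapl; rewrite mrunit_nat. Qed.

Lemma unit_mmap_inj A B (f g : hom A B) : idm I •₁ f = idm I •₁ g -> f = g.
Proof.
move=> e; apply: (iso_epi (i := uL A)).
by rewrite -!mlunit_nat e.
Qed.

Lemma mmap_unit_inj A B (f g : hom A B) : f •₁ idm I = g •₁ idm I -> f = g.
Proof.
move=> e; apply: (iso_epi (i := uR A)).
by rewrite -!mrunit_nat e.
Qed.

Definition miso A B A' B' (f : iso A A') (g : iso B B') : iso (A • B) (A' • B').
Proof.
exists (f •₁ g) (f^-1 •₁ g^-1).
- by rewrite -mmap_comp !iso_morK mmap_id.
- by rewrite -mmap_comp !iso_invK mmap_id.
Defined.

Definition idiso (A : C) : iso A A := Iso (comp_idl (idm A)) (comp_idl (idm A)).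

Lemma mlunit_assoc A B : a I A B ≫ uL (A • B) = uL A •₁ 𝟙.
Proof.
apply: unit_mmap_inj.
apply: (iso_epi (i := a I (I • A) B)) => /=.
apply: (iso_epi (i := miso (a I I A) (idiso B))) => /=.
rewrite mmap_compr (ra3 (mpentagon M I I A B)) comp_assoc mtriangle.
rewrite -massoc_nat -[RHS]comp_assoc -mmap_compl mtriangle.
by rewrite massoc_nat mmap_id.
Qed.

Lemma mrunit_assoc A B : a A B I ≫ 𝟙 •₁ uR B = uR (A • B).
Proof.
apply: mmap_unit_inj.
apply: (iso_mono (i := a A B I)).
rewrite mmap_compl comp_assoc massoc_nat -mtriangle mmap_compr.
rewrite (ra3 (mpentagon M A B I I)) comp_assoc -massoc_nat.
by rewrite mmap_id -(mtriangle M (A • B)) comp_assoc.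
Qed.

Lemma munit_unitors : iso_mor (uL I) = uR I.
Proof.
apply: mmap_unit_inj; rewrite -mtriangle -mlunit_assoc; congr (_ ≫ _).
apply: (iso_mono (i := uL I)).
by rewrite mlunit_nat.
Qed.

Lemma mtriangle_inv A B :
  (uR A)^-1 •₁ 𝟙 ≫ a A I B = 𝟙 •₁ (uL B)^-1.
Proof.
apply: (iso_mono (i := miso (idiso A) (uL B))) => /=.
rewrite comp_assoc mtriangle -mmap_compl -mmap_compr !iso_invK.
by rewrite !mmap_id.
Qed.

Lemma mlunit_assoc_inv A B : (uL (A • B))^-1 ≫ (a I A B)^-1 = (uL A)^-1 •₁ 𝟙.
Proof.
apply: (iso_mono (i := a I A B)); rewrite comp_assoc iso_invK comp_idr.
apply: (iso_mono (i := uL (A • B))); rewrite iso_invK comp_assoc mlunit_assoc.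
by rewrite -mmap_compl iso_invK mmap_id.
Qed.

Lemma mrunit_assoc_inv A B : 𝟙 •₁ (uR B)^-1 ≫ (a A B I)^-1 = (uR (A • B))^-1.
Proof.
apply: (iso_mono (i := a A B I)); rewrite comp_assoc iso_invK comp_idr.
apply: (iso_mono (i := miso (idiso A) (uR B))) => /=.
rewrite comp_assoc mrunit_assoc iso_invK.
by rewrite -mmap_compr iso_invK mmap_id.
Qed.

Lemma mlunit_assoc' A B : (a I A B)^-1 ≫ uL A •₁ 𝟙 = uL (A • B).
Proof. by rewrite -mlunit_assoc -comp_assoc iso_invK comp_idl. Qed.

Lemma mrunit_assoc' A B : (a A B I)^-1 ≫ uR (A • B) = 𝟙 •₁ uR B.
Proof. by rewrite -mrunit_assoc -comp_assoc iso_invK comp_idl. Qed.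

Lemma mtriangle_inv' A B : 𝟙 •₁ (uL B)^-1 ≫ (a A I B)^-1 = (uR A)^-1 •₁ 𝟙.
Proof. by rewrite -mtriangle_inv comp_assoc iso_morK comp_idr. Qed.

Lemma mlunit_assoc_inv' A B : (uL A)^-1 •₁ 𝟙 ≫ a I A B = (uL (A • B))^-1.
Proof. by rewrite -mlunit_assoc_inv comp_assoc iso_invK comp_idr. Qed.

Lemma mrunit_assoc_inv' A B : (uR (A • B))^-1 ≫ a A B I = 𝟙 •₁ (uR B)^-1.
Proof. by rewrite -mrunit_assoc_inv comp_assoc iso_invK comp_idr. Qed.

End MonoidalFacts.

Section Duals.
Variable X : LDC.

Definition dual_top_bot : linear_dual (X := X) ⊤ ⊥.
Proof.
exists ((uRP ⊤)^-1) (uRT ⊥ : hom (⊥ ⊗ ⊤) ⊥).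
- rewrite (ra (dR_uRT _ _)) (ra (mrunit_nat _ _)) comp_assoc iso_invK comp_idr.
  by rewrite -(munit_unitors tensor) iso_invK.
- rewrite (munit_unitors par) mrunit_nat (ra (dL_uRP _ _)).
  rewrite (ra (esym (mmap_compr _ _ _ _))).
  by rewrite iso_invK mmap_id comp_idl iso_invK.
Defined.

Definition dual_bot_top : linear_dual (X := X) ⊥ ⊤.
Proof.
exists ((uLP ⊤)^-1) (uLT ⊥ : hom (⊤ ⊗ ⊥) ⊥).
- rewrite -(munit_unitors par) mlunit_nat (ra (dR_uLP _ _)).
  rewrite (ra (esym (mmap_compl _ _ _ _))).
  by rewrite iso_invK mmap_id comp_idl iso_invK.
- rewrite (ra (dL_uLT _ _)) (ra (mlunit_nat _ _)) comp_assoc iso_invK comp_idr.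
  by rewrite (munit_unitors tensor) iso_invK.
Defined.

Lemma dR_aT_inv (A B C D : X) :
  dR (A ⊗ D) B C ≫ 𝟙 ⊕₁ (aT C A D)^-1
  = (aT (B ⊕ C) A D)^-1 ≫ dR A B C ⊗₁ 𝟙 ≫ dR D B (C ⊗ A).
Proof.
apply: (iso_epi (i := aT (B ⊕ C) A D)).
rewrite (ra (iso_morK _)) comp_idl -comp_assoc dR_aT.
rewrite !comp_assoc -mmap_compr iso_morK.
by rewrite mmap_id comp_idr.
Qed.

Lemma dL_aT_inv (A B C D : X) :
  𝟙 ⊗₁ dL B C D ≫ dL A (B ⊗ C) D ≫ (aT A B C)^-1 ⊕₁ 𝟙
  = (aT A B (C ⊕ D))^-1 ≫ dL (A ⊗ B) C D.
Proof.
apply: (iso_epi (i := aT A B (C ⊕ D))).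
rewrite (ra (iso_morK _)) comp_idl (ra3 (dL_aT _ _ _ _)).
rewrite comp_assoc -mmap_compl iso_morK.
by rewrite mmap_id comp_idr.
Qed.

Lemma dR_natr (A A' B C : X) (f : hom A A') :
  𝟙 ⊗₁ f ≫ dR A' B C = dR A B C ≫ 𝟙 ⊕₁ (𝟙 ⊗₁ f).
Proof. by rewrite -dR_nat mmap_id. Qed.

Lemma dL_natl (A A' B C : X) (f : hom A A') :
  f ⊗₁ 𝟙 ≫ dL A' B C = dL A B C ≫ (f ⊗₁ 𝟙) ⊕₁ 𝟙.
Proof. by rewrite -dL_nat mmap_id. Qed.

Lemma dR_uRT_inv (B C : X) : (uRT (B ⊕ C))^-1 ≫ dR ⊤ B C = 𝟙 ⊕₁ (uRT C)^-1.
Proof.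
apply: (iso_mono (i := miso par (idiso B) (uRT C))) => /=.
by rewrite comp_assoc dR_uRT iso_invK -mmap_compr iso_invK mmap_id.
Qed.

Lemma dL_uLT_inv (B C : X) : (uLT (B ⊕ C))^-1 ≫ dL ⊤ B C = (uLT B)^-1 ⊕₁ 𝟙.
Proof.
apply: (iso_mono (i := miso par (uLT B) (idiso C))) => /=.
by rewrite comp_assoc dL_uLT iso_invK -mmap_compl iso_invK mmap_id.
Qed.

Lemma dL_aP_inv (A B C D : X) :
  𝟙 ⊗₁ (aP B C D)^-1 ≫ dL A (B ⊕ C) D ≫ dL A B C ⊕₁ 𝟙
  = dL A B (C ⊕ D) ≫ (aP (A ⊗ B) C D)^-1.
Proof.
apply: (iso_mono (i := aP (A ⊗ B) C D)).
rewrite !comp_assoc iso_invK comp_idr -dL_aP -comp_assoc -mmap_compr iso_invK.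
by rewrite mmap_id comp_idl.
Qed.

Lemma dR_aP_inv (A B C D : X) :
  (aP B C D)^-1 ⊗₁ 𝟙 ≫ dR A (B ⊕ C) D
  = dR A B (C ⊕ D) ≫ 𝟙 ⊕₁ dR A C D ≫ (aP B C (D ⊗ A))^-1.
Proof.
apply: (iso_mono (i := aP B C (D ⊗ A))).
rewrite !comp_assoc iso_invK comp_idr -dR_aP -comp_assoc -mmap_compl iso_invK.
by rewrite mmap_id comp_idl.
Qed.

Lemma dLR_aT_inv (A B C D : X) :
  𝟙 ⊗₁ dR D B C ≫ dL A B (C ⊗ D)
  = (aT A (B ⊕ C) D)^-1 ≫ dL A B C ⊗₁ 𝟙 ≫ dR D (A ⊗ B) C.
Proof. by rewrite -dLR_aT -comp_assoc iso_invK comp_idl. Qed.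

Section TensorPar.
Variables (A A' B B' : X) (dA : linear_dual A A') (dB : linear_dual B B').

Definition tensor_par_eta : hom ⊤ ((A ⊗ B) ⊕ (B' ⊕ A')) :=
  eta dA ≫ ((uRT A)^-1 ≫ 𝟙 ⊗₁ eta dB ≫ dL A B B') ⊕₁ 𝟙
    ≫ aP (A ⊗ B) B' A'.

Definition tensor_par_eps : hom ((B' ⊕ A') ⊗ (A ⊗ B)) ⊥ :=
  (aT (B' ⊕ A') A B)^-1 ≫ (dR A B' A' ≫ 𝟙 ⊕₁ eps dA ≫ uRP B') ⊗₁ 𝟙
    ≫ eps dB.

Lemma tensor_par_inner_left (P : X) (g : hom A (P ⊕ B')) :
  (uLT A)^-1 ≫ (eta dA ≫ g ⊕₁ 𝟙 ≫ aP P B' A') ⊗₁ 𝟙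
    ≫ dR A P (B' ⊕ A') ≫ 𝟙 ⊕₁ (dR A B' A' ≫ 𝟙 ⊕₁ eps dA ≫ uRP B') = g.
Proof.
rewrite !mmap_compl !mmap_compr !comp_assoc (ra3 (dR_aP _ _ _ _)) !comp_assoc.
rewrite (ra (esym (massoc_nat _ _ _ _))) !comp_assoc mrunit_assoc mmap_id.
rewrite (ra (dR_nat _ _ _)) !comp_assoc mmap_id (ra (esym (mmap_swap _ _ _))).
rewrite !comp_assoc mrunit_nat -[RHS]comp_idl -[in RHS](dual_zigzag_left dA).
by rewrite !comp_assoc.
Qed.

Lemma tensor_par_outer_left :
  ((uRT A)^-1 ≫ 𝟙 ⊗₁ eta dB ≫ dL A B B') ⊗₁ 𝟙
    ≫ dR B (A ⊗ B) B' ≫ 𝟙 ⊕₁ eps dB ≫ uRP (A ⊗ B) = 𝟙.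
Proof.
rewrite !mmap_compl !comp_assoc (ra (esym (dLR_aT _ _ _ _))) !comp_assoc.
rewrite (ra (massoc_nat _ _ _ _)) !comp_assoc (ra (mtriangle_inv _ _ _)).
rewrite -(mmap_id _ A B) (ra (esym (dL_nat _ _ _))) mmap_id !comp_assoc dL_uRP.
by rewrite -!mmap_compr dual_zigzag_left mmap_id.
Qed.

Lemma tensor_par_zigzag_left :
  (uLT (A ⊗ B))^-1 ≫ tensor_par_eta ⊗₁ 𝟙 ≫ dR (A ⊗ B) (A ⊗ B) (B' ⊕ A')
    ≫ 𝟙 ⊕₁ tensor_par_eps ≫ uRP (A ⊗ B) = 𝟙.
Proof.
rewrite /tensor_par_eta /tensor_par_eps.
set g := (uRT A)^-1 ≫ _; set k := dR A B' A' ≫ _.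
move: tensor_par_outer_left (tensor_par_inner_left g); rewrite -/g -/k.
move: g k => g k outer inner.
rewrite [𝟙 ⊕₁ (_ ≫ _)]mmap_compr !comp_assoc (ra (dR_aT_inv _ _ _ _)) !comp_assoc.
rewrite -(mmap_id _ A B) (ra (esym (massoc_inv_nat _ _ _ _))) !comp_assoc.
rewrite (ra (mlunit_assoc_inv _ _ _)) mmap_id mmap_compr !comp_assoc.
rewrite (ra (esym (dR_nat _ _ _))) !comp_assoc ?mmap_id.
rewrite -[RHS]outer -[in RHS]inner.
by rewrite !mmap_compl !comp_assoc.
Qed.

Lemma tensor_par_inner_right (Q : X) (k : hom (Q ⊗ A) B') :
  𝟙 ⊗₁ ((uRT A)^-1 ≫ 𝟙 ⊗₁ eta dB ≫ dL A B B') ≫ dL Q (A ⊗ B) B'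
    ≫ ((aT Q A B)^-1 ≫ k ⊗₁ 𝟙 ≫ eps dB) ⊕₁ 𝟙 ≫ uLP B' = k.
Proof.
rewrite !mmap_compl !mmap_compr !comp_assoc.
rewrite (ra3 (dL_aT_inv _ _ _ _)) !comp_assoc.
rewrite (ra (esym (massoc_inv_nat _ _ _ _))) !comp_assoc (ra (mrunit_assoc_inv _ _ _)).
rewrite (ra (esym (dL_nat _ _ _))) !comp_assoc mmap_id !mmap_id.
rewrite (ra (mmap_swap _ _ _)) !comp_assoc (ra (mrunit_inv_nat _ _)) !comp_assoc.
by rewrite dual_zigzag_right comp_idr.
Qed.

Lemma tensor_par_outer_right :
  (uRT (B' ⊕ A'))^-1 ≫ 𝟙 ⊗₁ eta dA ≫ dL (B' ⊕ A') A A'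
    ≫ (dR A B' A' ≫ 𝟙 ⊕₁ eps dA ≫ uRP B') ⊕₁ 𝟙 = 𝟙.
Proof.
rewrite !mmap_compl -mtriangle (ra (massoc_nat _ _ _ _)) !comp_assoc.
rewrite (ra3 (dLR_aP _ _ _ _)) !comp_assoc.
rewrite (ra (dR_natr _ _ _)) !comp_assoc (ra (dR_uRT_inv _ _)).
by rewrite -!mmap_compr dual_zigzag_right mmap_id.
Qed.

Lemma tensor_par_zigzag_right :
  (uRT (B' ⊕ A'))^-1 ≫ 𝟙 ⊗₁ tensor_par_eta ≫ dL (B' ⊕ A') (A ⊗ B) (B' ⊕ A')
    ≫ tensor_par_eps ⊕₁ 𝟙 ≫ uLP (B' ⊕ A') = 𝟙.
Proof.
rewrite /tensor_par_eta /tensor_par_eps -[RHS]tensor_par_outer_right.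
set k := dR A B' A' ≫ _; rewrite -[in RHS](tensor_par_inner_right k).
move: k => k; set g := (uRT A)^-1 ≫ _; move: g => g.
set e := (aT _ _ _)^-1 ≫ _; move: e => e.
rewrite !mmap_compl !mmap_compr !comp_assoc (ra (dL_aP _ _ _ _)) !comp_assoc.
rewrite -[in e ⊕₁ 𝟙](mmap_id par B' A') (ra (esym (massoc_nat _ _ _ _))).
by rewrite !comp_assoc mlunit_assoc (ra (dL_nat _ _ _)) !comp_assoc.
Qed.

Definition tensor_par_dual : linear_dual (A ⊗ B) (B' ⊕ A') :=
  LinearDual tensor_par_zigzag_left tensor_par_zigzag_right.

End TensorPar.

Section ParTensor.
Variables (A A' B B' : X) (dA : linear_dual A' A) (dB : linear_dual B' B).

Definition par_tensor_eta : hom ⊤ ((B' ⊕ A') ⊕ (A ⊗ B)) :=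
  eta dB ≫ 𝟙 ⊕₁ ((uLT B)^-1 ≫ eta dA ⊗₁ 𝟙 ≫ dR B A' A)
    ≫ (aP B' A' (A ⊗ B))^-1.

Definition par_tensor_eps : hom ((A ⊗ B) ⊗ (B' ⊕ A')) ⊥ :=
  aT A B (B' ⊕ A') ≫ 𝟙 ⊗₁ (dL B B' A' ≫ eps dB ⊕₁ 𝟙 ≫ uLP A')
    ≫ eps dA.

Lemma par_tensor_inner_right (P : X) (g : hom B (A' ⊕ P)) :
  (uRT B)^-1 ≫ 𝟙 ⊗₁ (eta dB ≫ 𝟙 ⊕₁ g ≫ (aP B' A' P)^-1)
    ≫ dL B (B' ⊕ A') P ≫ (dL B B' A' ≫ eps dB ⊕₁ 𝟙 ≫ uLP A') ⊕₁ 𝟙 = g.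
Proof.
rewrite !mmap_compl !mmap_compr !comp_assoc (ra3 (dL_aP_inv _ _ _ _)) !comp_assoc.
rewrite (ra (massoc_inv_nat _ _ _ _)) !comp_assoc mlunit_assoc' mmap_id.
rewrite (ra (dL_nat _ _ _)) !comp_assoc mmap_id (ra (mmap_swap _ _ _)).
rewrite !comp_assoc mlunit_nat -[RHS]comp_idl -[in RHS](dual_zigzag_right dB).
by rewrite !comp_assoc.
Qed.

Lemma par_tensor_outer_right :
  𝟙 ⊗₁ ((uLT B)^-1 ≫ eta dA ⊗₁ 𝟙 ≫ dR B A' A)
    ≫ dL A A' (A ⊗ B) ≫ eps dA ⊕₁ 𝟙 ≫ uLP (A ⊗ B) = 𝟙.
Proof.
rewrite !mmap_compr !comp_assoc (ra (dLR_aT_inv _ _ _ _)) !comp_assoc.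
rewrite (ra (esym (massoc_inv_nat _ _ _ _))) !comp_assoc.
rewrite (ra (mtriangle_inv' _ _ _)).
rewrite -(mmap_id _ A B) (ra (esym (dR_nat _ _ _))) mmap_id !comp_assoc dR_uLP.
by rewrite -!mmap_compl dual_zigzag_right mmap_id.
Qed.

Lemma par_tensor_zigzag_right :
  (uRT (A ⊗ B))^-1 ≫ 𝟙 ⊗₁ par_tensor_eta ≫ dL (A ⊗ B) (B' ⊕ A') (A ⊗ B)
    ≫ par_tensor_eps ⊕₁ 𝟙 ≫ uLP (A ⊗ B) = 𝟙.
Proof.
rewrite /par_tensor_eta /par_tensor_eps.
set g := (uLT B)^-1 ≫ _; set k := dL B B' A' ≫ _.
move: par_tensor_outer_right (par_tensor_inner_right g); rewrite -/g -/k.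
move: g k => g k outer inner.
rewrite [_ ⊕₁ 𝟙]mmap_compl !comp_assoc (ra (esym (dL_aT _ _ _ _))) !comp_assoc.
rewrite -(mmap_id _ A B) (ra (massoc_nat _ _ _ _)) !comp_assoc.
rewrite (ra (mrunit_assoc_inv' _ _ _)) mmap_id mmap_compl !comp_assoc.
rewrite (ra (esym (dL_nat _ _ _))) !comp_assoc.
rewrite -[RHS]outer -[in RHS]inner.
by rewrite !mmap_compr !comp_assoc.
Qed.

Lemma par_tensor_inner_left (Q : X) (k : hom (B ⊗ Q) A') :
  ((uLT B)^-1 ≫ eta dA ⊗₁ 𝟙 ≫ dR B A' A) ⊗₁ 𝟙 ≫ dR Q A' (A ⊗ B)
    ≫ 𝟙 ⊕₁ (aT A B Q ≫ 𝟙 ⊗₁ k ≫ eps dA) ≫ uRP A' = k.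
Proof.
rewrite !mmap_compl !mmap_compr !comp_assoc.
rewrite (ra3 (esym (dR_aT _ _ _ _))) !comp_assoc.
rewrite (ra (massoc_nat _ _ _ _)) !comp_assoc (ra (mlunit_assoc_inv' _ _ _)).
rewrite (ra (esym (dR_nat _ _ _))) !comp_assoc !mmap_id.
rewrite (ra (esym (mmap_swap _ _ _))) !comp_assoc (ra (mlunit_inv_nat _ _)).
by rewrite !comp_assoc dual_zigzag_left comp_idr.
Qed.

Lemma par_tensor_outer_left :
  (uLT (B' ⊕ A'))^-1 ≫ eta dB ⊗₁ 𝟙 ≫ dR (B' ⊕ A') B' B
    ≫ 𝟙 ⊕₁ (dL B B' A' ≫ eps dB ⊕₁ 𝟙 ≫ uLP A') = 𝟙.
Proof.
rewrite !mmap_compr (ra (esym (dLR_aP _ _ _ _))) !comp_assoc.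
rewrite (ra (esym (massoc_nat _ _ _ _))) !comp_assoc mtriangle.
rewrite (ra (dL_natl _ _ _)) !comp_assoc (ra (dL_uLT_inv _ _)).
by rewrite -!mmap_compl dual_zigzag_left mmap_id.
Qed.

Lemma par_tensor_zigzag_left :
  (uLT (B' ⊕ A'))^-1 ≫ par_tensor_eta ⊗₁ 𝟙 ≫ dR (B' ⊕ A') (B' ⊕ A') (A ⊗ B)
    ≫ 𝟙 ⊕₁ par_tensor_eps ≫ uRP (B' ⊕ A') = 𝟙.
Proof.
rewrite /par_tensor_eta /par_tensor_eps -[RHS]par_tensor_outer_left.
set k := dL B B' A' ≫ _; rewrite -[in RHS](par_tensor_inner_left k).
move: k => k; set g := (uLT B)^-1 ≫ _; move: g => g.
set e := aT _ _ _ ≫ _; move: e => e.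
rewrite !mmap_compl !mmap_compr !comp_assoc (ra (dR_aP_inv _ _ _ _)) !comp_assoc.
rewrite -[in 𝟙 ⊕₁ e](mmap_id par B' A') (ra (massoc_inv_nat _ _ _ _)).
by rewrite !comp_assoc mrunit_assoc' (ra (dR_nat _ _ _)) !comp_assoc.
Qed.

Definition par_tensor_dual : linear_dual (B' ⊕ A') (A ⊗ B) :=
  LinearDual par_tensor_zigzag_left par_tensor_zigzag_right.

End ParTensor.
End Duals.

Definition left_dual_iso (X : LDC) (A B C : X)
    (d : linear_dual B A) (d' : linear_dual C A) : hom B C :=
  (uLT B)^-1 ≫ eta d' ⊗₁ 𝟙 ≫ dR B C A ≫ 𝟙 ⊕₁ eps d ≫ uRP C.

Definition right_dual_iso (X : LDC) (A B C : X)
    (d : linear_dual A B) (d' : linear_dual A C) : hom B C :=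
  (uRT B)^-1 ≫ 𝟙 ⊗₁ eta d' ≫ dL B A C ≫ eps d ⊕₁ 𝟙 ≫ uLP C.

Record star_autonomous (X : LDC) := StarAutonomous {
  lstar : X -> X;
  rstar : X -> X;
  lstar_dual : forall A : X, linear_dual (lstar A) A;
  rstar_dual : forall A : X, linear_dual A (rstar A)
}.

Section Cyclor.
Variables (X : LDC) (S : star_autonomous X).
Local Notation "A ^*" := (lstar S A) (at level 1, left associativity, format "A ^*").
Local Notation "⋆ A" := (rstar S A) (at level 1, A at level 1, format "⋆ A").
Local Notation τ := (lstar_dual S).
Local Notation γ := (rstar_dual S).

(* The actions on maps are the mates of [f] under the chosen duals. *)
Definition lstar_map (A B : X) (f : hom A B) : hom B^* A^* :=
  (uLT B^*)^-1 ≫ eta (τ A) ⊗₁ 𝟙 ≫ dR B^* A^* A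
    ≫ 𝟙 ⊕₁ (f ⊗₁ 𝟙 ≫ eps (τ B)) ≫ uRP A^*.

Definition rstar_map (A B : X) (f : hom A B) : hom (⋆B) (⋆A) :=
  (uRT ⋆B)^-1 ≫ 𝟙 ⊗₁ eta (γ A) ≫ dL (⋆B) A (⋆A)
    ≫ (𝟙 ⊗₁ f ≫ eps (γ B)) ⊕₁ 𝟙 ≫ uLP ⋆A.

Record cyclor := Cyclor {
  cyc :> forall A : X, iso A^* (⋆A);
  cyc_nat : forall (A B : X) (f : hom A B),
    lstar_map f ≫ cyc A = cyc B ≫ rstar_map f;
  cyc_bot :
    cyc ⊥ ≫ right_dual_iso (γ ⊥) (dual_bot_top X)
    = left_dual_iso (τ ⊥) (dual_top_bot X);
  cyc_double : forall A : X,
    left_dual_iso (γ A) (τ (⋆A)) ≫ lstar_map (cyc A) ≫ cyc A^*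
    = right_dual_iso (τ A) (γ A^*);
  cyc_top :
    cyc ⊤ ≫ right_dual_iso (γ ⊤) (dual_top_bot X)
    = left_dual_iso (τ ⊤) (dual_bot_top X);
  cyc_tensor : forall A B : X,
    cyc (A ⊗ B) ≫ right_dual_iso (γ (A ⊗ B)) (tensor_par_dual (γ A) (γ B))
    = left_dual_iso (τ (A ⊗ B)) (par_tensor_dual (τ A) (τ B))
      ≫ cyc B ⊕₁ cyc A;
  cyc_par : forall A B : X,
    cyc (A ⊕ B) ≫ right_dual_iso (γ (A ⊕ B)) (par_tensor_dual (γ B) (γ A))
    = left_dual_iso (τ (A ⊕ B)) (tensor_par_dual (τ B) (τ A))
      ≫ cyc B ⊗₁ cyc A
}.
End Cyclor.

Section ConjMonoidal.
Variables (C : category) (M : monoidal C) (F : functor C C).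
Variable eps : forall A : C, iso (F (F A)) A.
Local Notation "A • B" := (mob M A B) (at level 40, left associativity).
Local Notation "f •₁ g" := (mmap M f g) (at level 40, left associativity).
Local Notation I := (munit M).
Variable chi : forall A B : C, iso (F A • F B) (F (B • A)).

Record conj_monoidal : Prop := ConjMonoidal {
  chi_nat : forall (A B A' B' : C) (f : hom A A') (g : hom B B'),
    fmap F f •₁ fmap F g ≫ chi A' B' = chi A B ≫ fmap F (g •₁ f);
  chi_assoc : forall A B D : C,
    massoc M (F A) (F B) (F D) ≫ 𝟙 •₁ chi B D ≫ chi A (D • B)
    = chi A B •₁ 𝟙 ≫ chi (B • A) D ≫ fmap F (massoc M D B A)^-1;
  chi_eps : forall A B : C,
    chi (F A) (F B) ≫ fmap F (chi B A) ≫ eps (A • B) = eps A •₁ eps B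
}.

End ConjMonoidal.

Record conjugation (X : LDC) := Conjugation {
  conj :> functor X X;
  chiT : forall A B : X, iso (conj A ⊗ conj B) (conj (B ⊗ A));
  chiP : forall A B : X, iso (conj (A ⊕ B)) (conj B ⊕ conj A);
  cjeps : forall A : X, iso (conj (conj A)) A;
  cjeps_nat : forall (A B : X) (f : hom A B),
    fmap conj (fmap conj f) ≫ cjeps B = cjeps A ≫ f;
  cjeps_conj : forall A : X, fmap conj (cjeps A) = cjeps (conj A);
  chiT_monoidal : conj_monoidal cjeps chiT;
  chiP_monoidal : conj_monoidal cjeps (fun A B => iso_sym (chiP B A));
  conj_dR : forall A B C : X,
    chiP B C ⊗₁ 𝟙 ≫ dR (conj A) (conj C) (conj B) ≫ 𝟙 ⊕₁ chiT B A
    = chiT (B ⊕ C) A ≫ fmap conj (dL A B C) ≫ chiP (A ⊗ B) C;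
  conj_dL : forall A B C : X,
    𝟙 ⊗₁ chiP C B ≫ dL (conj A) (conj B) (conj C) ≫ chiT A B ⊕₁ 𝟙
    = chiT A (C ⊕ B) ≫ fmap conj (dR A C B) ≫ chiP C (B ⊗ A)
}.

Section ConjUnit.
Variables (C : category) (M : monoidal C) (F : functor C C).
Variable eps : forall A : C, iso (F (F A)) A.
Local Notation "A • B" := (mob M A B) (at level 40, left associativity).
Local Notation "f •₁ g" := (mmap M f g) (at level 40, left associativity).
Local Notation I := (munit M).
Variable chi : forall A B : C, iso (F A • F B) (F (B • A)).

(* The unique comparison I ≅ F I, obtained by solving
   [conj_unit_left] below at [A := F I]. *)
Definition conj_unit : hom I (F I) :=
  (eps I)^-1 ≫ fmap F (mrunit M (F I))^-1 ≫ (chi I (F I))^-1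
    ≫ 𝟙 •₁ eps I ≫ mrunit M (F I).

Definition conj_unit_inv : hom (F I) I :=
  (mrunit M (F I))^-1 ≫ 𝟙 •₁ (eps I)^-1 ≫ chi I (F I)
    ≫ fmap F (mrunit M (F I)) ≫ eps I.

Lemma conj_unitK : conj_unit ≫ conj_unit_inv = idm I.
Proof.
rewrite /conj_unit /conj_unit_inv !comp_assoc (ra (iso_morK _)) comp_idl.
rewrite (ra (esym (mmap_compr _ _ _ _))) iso_morK mmap_id comp_idl.
rewrite (ra (iso_invK _)) comp_idl (ra (esym (fmap_comp _ _ _))).
by rewrite iso_invK fmap_id comp_idl iso_invK.
Qed.

Lemma conj_unit_invK : conj_unit_inv ≫ conj_unit = idm (F I).
Proof.
rewrite /conj_unit /conj_unit_inv !comp_assoc (ra (iso_morK _)) comp_idl.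
rewrite (ra (esym (fmap_comp _ _ _))) iso_morK fmap_id comp_idl.
rewrite (ra (iso_morK _)) comp_idl (ra (esym (mmap_compr _ _ _ _))) iso_invK mmap_id.
by rewrite comp_idl iso_invK.
Qed.

Definition conj_unit_iso : iso I (F I) := Iso conj_unitK conj_unit_invK.

Hypothesis eps_nat : forall (A B : C) (f : hom A B),
  fmap F (fmap F f) ≫ eps B = eps A ≫ f.
Hypothesis eps_conj : forall A : C, fmap F (eps A) = eps (F A).
Hypothesis chiM : conj_monoidal eps chi.

Definition lact (A : C) : hom (F I • F A) (F A) :=
  locked (chi I A ≫ fmap F (mrunit M A)).
Definition lact_ext (A : C) : hom (F I • A) A :=
  locked (𝟙 •₁ (eps A)^-1 ≫ lact (F A) ≫ eps A).

Lemma lactE A : lact A = chi I A ≫ fmap F (mrunit M A).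
Proof. by rewrite /lact -lock. Qed.
Lemma lact_extE A : lact_ext A = 𝟙 •₁ (eps A)^-1 ≫ lact (F A) ≫ eps A.
Proof. by rewrite /lact_ext -lock. Qed.

Lemma chi_natl (A A' B : C) (f : hom A A') :
  fmap F f •₁ 𝟙 ≫ chi A' B = chi A B ≫ fmap F (𝟙 •₁ f).
Proof. by rewrite -(chi_nat chiM) fmap_id. Qed.

Lemma chi_natr (A B B' : C) (f : hom B B') :
  𝟙 •₁ fmap F f ≫ chi A B' = chi A B ≫ fmap F (f •₁ 𝟙).
Proof. by rewrite -(chi_nat chiM) fmap_id. Qed.

Lemma lact_nat A B (f : hom A B) : 𝟙 •₁ fmap F f ≫ lact B = lact A ≫ fmap F f.
Proof.
by rewrite !lactE (ra (chi_natr _ _)) !comp_assoc -!fmap_comp mrunit_nat.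
Qed.

Lemma lact_ext_nat A B (f : hom A B) : 𝟙 •₁ f ≫ lact_ext B = lact_ext A ≫ f.
Proof.
rewrite !lact_extE (ra (esym (mmap_compr _ _ _ _))).
have -> : f ≫ (eps B)^-1 = (eps A)^-1 ≫ fmap F (fmap F f).
  apply: (iso_mono (i := eps B)).
  by rewrite !comp_assoc iso_invK eps_nat comp_idr (ra (iso_invK _)) comp_idl.
by rewrite mmap_compr !comp_assoc (ra (lact_nat _)) !comp_assoc eps_nat.
Qed.

Lemma lact_ext_conj A : lact_ext (F A) = lact A.
Proof.
rewrite !lact_extE -eps_conj -lact_nat (ra (esym (mmap_compr _ _ _ _))).
by rewrite eps_conj iso_invK mmap_id comp_idl.
Qed.

Lemma lact_assoc B D :
  massoc M (F I) (F B) (F D) ≫ 𝟙 •₁ chi B D ≫ lact (D • B) = lact B •₁ 𝟙 ≫ chi B D.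
Proof.
rewrite !lactE (ra3 (chi_assoc chiM _ _ _)) !comp_assoc -fmap_comp mrunit_assoc'.
by rewrite mmap_compl !comp_assoc chi_natl.
Qed.

Lemma lact_ext_assoc B D : massoc M (F I) B D ≫ lact_ext (B • D) = lact_ext B •₁ 𝟙.
Proof.
apply: (iso_epi (i := miso M (miso M (idiso (F I)) (eps B)) (eps D))) => /=.
rewrite (ra (massoc_nat _ _ _ _)) !comp_assoc -mmap_comp comp_idr.
rewrite -(chi_eps chiM) !mmap_compr !comp_assoc [in RHS]lact_ext_nat lact_ext_conj.
rewrite lact_ext_nat (ra (lact_ext_nat _)) !comp_assoc lact_ext_conj.
rewrite (ra3 (lact_assoc _ _)) !comp_assoc.
by rewrite (chi_eps chiM) -mmap_comp comp_idl.
Qed.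

Lemma conj_unit_inv_left A : conj_unit_inv •₁ 𝟙 ≫ mlunit M A = lact_ext A.
Proof.
have -> : conj_unit_inv = (mrunit M (F I))^-1 ≫ lact_ext I.
  by rewrite /conj_unit_inv lact_extE lactE !comp_assoc.
rewrite mmap_compl !comp_assoc -lact_ext_assoc !comp_assoc -lact_ext_nat.
rewrite (ra (mtriangle M _ _)) (ra (esym (mmap_compl _ _ _ _))) iso_invK.
by rewrite mmap_id comp_idl.
Qed.

Lemma conj_unit_left A :
  conj_unit •₁ 𝟙 ≫ chi I A = mlunit M (F A) ≫ fmap F (mrunit M A)^-1.
Proof.
apply: (iso_epi (i := miso M (iso_sym conj_unit_iso) (idiso (F A)))) => /=.
rewrite (ra (esym (mmap_compl _ _ _ _))) conj_unit_invK mmap_id comp_idl.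
rewrite (ra (conj_unit_inv_left _)) lact_ext_conj lactE comp_assoc -fmap_comp iso_morK.
by rewrite fmap_id comp_idr.
Qed.

Lemma conj_unit_right A :
  𝟙 •₁ conj_unit ≫ chi A I = mrunit M (F A) ≫ fmap F (mlunit M A)^-1.
Proof.
suff e : chi A I ≫ fmap F (mlunit M A) = 𝟙 •₁ conj_unit_inv ≫ mrunit M (F A).
  apply: (iso_epi (i := miso M (idiso (F A)) (iso_sym conj_unit_iso))) => /=.
  rewrite (ra (esym (mmap_compr _ _ _ _))) conj_unit_invK mmap_id comp_idl.
  by rewrite (ra (esym e)) comp_assoc -fmap_comp iso_morK fmap_id comp_idr.
apply: (mmap_unit_inj (M := M)).
apply: (iso_epi (i := miso M (idiso _) (iso_sym conj_unit_iso))) => /=.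
rewrite !mmap_swap; congr (_ ≫ _).
apply: (iso_mono (i := chi A I)).
rewrite mmap_compl !comp_assoc chi_natl.
have -> : idm I •₁ mlunit M A
    = (massoc M I I A)^-1 ≫ mrunit M I •₁ 𝟙.
  by rewrite -mtriangle (ra (iso_invK _)) comp_idl.
rewrite fmap_comp (ra3 (esym (chi_assoc chiM _ _ _))) !comp_assoc -chi_natr.
rewrite (ra (esym (mmap_compr _ _ _ _))) -lactE -lact_ext_conj -conj_unit_inv_left.
rewrite mmap_compr !comp_assoc (ra (esym (massoc_nat _ _ _ _))) !comp_assoc.
by rewrite (ra (mtriangle M _ _)) mmap_compl !comp_assoc.
Qed.

End ConjUnit.

Section ConjDual.
Variables (X : LDC) (K : conjugation X).

Definition conj_top : iso ⊤ (K ⊤) := conj_unit_iso (M := tensor) (cjeps K) (chiT K).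
Definition conj_bot : iso ⊥ (K ⊥) :=
  conj_unit_iso (M := par) (cjeps K) (fun A B => iso_sym (chiP K B A)).

Lemma conj_top_left (A : X) :
  conj_top ⊗₁ 𝟙 ≫ chiT K ⊤ A = uLT (K A) ≫ fmap K (uRT A)^-1.
Proof.
exact: (conj_unit_left (@cjeps_nat _ K) (@cjeps_conj _ K) (chiT_monoidal K)).
Qed.

Lemma conj_top_right (A : X) :
  𝟙 ⊗₁ conj_top ≫ chiT K A ⊤ = uRT (K A) ≫ fmap K (uLT A)^-1.
Proof.
exact: (conj_unit_right (@cjeps_nat _ K) (@cjeps_conj _ K) (chiT_monoidal K)).
Qed.

Lemma conj_bot_left (A : X) :
  conj_bot ⊕₁ 𝟙 ≫ (chiP K A ⊥)^-1 = uLP (K A) ≫ fmap K (uRP A)^-1.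
Proof.
exact: (conj_unit_left (@cjeps_nat _ K) (@cjeps_conj _ K) (chiP_monoidal K)).
Qed.

Lemma conj_bot_right (A : X) :
  𝟙 ⊕₁ conj_bot ≫ (chiP K ⊥ A)^-1 = uRP (K A) ≫ fmap K (uLP A)^-1.
Proof.
exact: (conj_unit_right (@cjeps_nat _ K) (@cjeps_conj _ K) (chiP_monoidal K)).
Qed.

Lemma chiP_nat (A B A' B' : X) (f : hom A A') (g : hom B B') :
  chiP K A B ≫ fmap K g ⊕₁ fmap K f = fmap K (f ⊕₁ g) ≫ chiP K A' B'.
Proof.
apply: (iso_mono (i := iso_sym (chiP K A' B'))) => /=.
rewrite !comp_assoc (chi_nat (chiP_monoidal K)) /= (ra (iso_morK _)) comp_idl.
by rewrite iso_morK comp_idr.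
Qed.

Lemma conj_bot_right_inv (A : X) :
  chiP K ⊥ A ≫ 𝟙 ⊕₁ conj_bot^-1 ≫ uRP (K A) = fmap K (uLP A).
Proof.
move: conj_bot (conj_bot_right A) => b eb.
apply: (iso_epi (i := iso_sym (chiP K ⊥ A))) => /=.
rewrite (ra (iso_invK _)) comp_idl.
apply: (iso_epi (i := miso par (idiso (K A)) b)) => /=.
rewrite (ra (esym (mmap_compr _ _ _ _))) iso_morK mmap_id comp_idl.
rewrite (ra eb) comp_assoc -fmap_comp iso_invK.
by rewrite fmap_id comp_idr.
Qed.

Lemma conj_bot_left_inv (A : X) :
  chiP K A ⊥ ≫ conj_bot^-1 ⊕₁ 𝟙 ≫ uLP (K A) = fmap K (uRP A).
Proof.
move: conj_bot (conj_bot_left A) => b eb.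
apply: (iso_epi (i := iso_sym (chiP K A ⊥))) => /=.
rewrite (ra (iso_invK _)) comp_idl.
apply: (iso_epi (i := miso par b (idiso (K A)))) => /=.
rewrite (ra (esym (mmap_compl _ _ _ _))) iso_morK mmap_id comp_idl.
rewrite (ra eb) comp_assoc -fmap_comp iso_invK.
by rewrite fmap_id comp_idr.
Qed.

Variables (A B : X) (d : linear_dual B A).

Definition conj_eta : hom ⊤ (K A ⊕ K B) :=
  conj_top ≫ fmap K (eta d) ≫ chiP K B A.
Definition conj_eps : hom (K B ⊗ K A) ⊥ :=
  chiT K B A ≫ fmap K (eps d) ≫ conj_bot^-1.

Lemma conj_zigzag_left :
  (uLT (K A))^-1 ≫ conj_eta ⊗₁ 𝟙 ≫ dR (K A) (K A) (K B)
    ≫ 𝟙 ⊕₁ conj_eps ≫ uRP (K A) = 𝟙.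
Proof.
rewrite /conj_eta /conj_eps; move: (conj_top_left A) (conj_bot_right_inv A).
move: conj_top conj_bot => t b et eb.
rewrite !mmap_compl !mmap_compr !comp_assoc (ra3 (conj_dR _ _ _ _)) !comp_assoc.
rewrite (ra (chi_natl (chiT_monoidal K) _ _)) !comp_assoc (ra et) !comp_assoc.
rewrite (ra (iso_invK _)) comp_idl -(fmap_id K) (ra (chiP_nat _ _)) fmap_id.
rewrite !comp_assoc eb -!fmap_comp.
by rewrite dual_zigzag_right fmap_id.
Qed.

Lemma conj_zigzag_right :
  (uRT (K B))^-1 ≫ 𝟙 ⊗₁ conj_eta ≫ dL (K B) (K A) (K B)
    ≫ conj_eps ⊕₁ 𝟙 ≫ uLP (K B) = 𝟙.
Proof.
rewrite /conj_eta /conj_eps; move: (conj_top_right B) (conj_bot_left_inv B).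
move: conj_top conj_bot => t b et eb.
rewrite !mmap_compl !mmap_compr !comp_assoc (ra3 (conj_dL _ _ _ _)) !comp_assoc.
rewrite (ra (chi_natr (chiT_monoidal K) _ _)) !comp_assoc (ra et) !comp_assoc.
rewrite (ra (iso_invK _)) comp_idl -(fmap_id K) (ra (chiP_nat _ _)) fmap_id.
rewrite !comp_assoc eb -!fmap_comp.
by rewrite dual_zigzag_left fmap_id.
Qed.

Definition conj_dual : linear_dual (K A) (K B) :=
  LinearDual conj_zigzag_left conj_zigzag_right.

End ConjDual.

Record conjugative_cyclic_star_autonomous (X : LDC) := ConjCycStarAut {
  ccs_star : star_autonomous X;
  ccs_conj : conjugation X;
  ccs_cyclor : cyclor ccs_star;
  ccs_compat : forall A : X,
    ccs_cyclor (ccs_conj A)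
      ≫ right_dual_iso (rstar_dual ccs_star (ccs_conj A))
          (conj_dual ccs_conj (lstar_dual ccs_star A))
    = left_dual_iso (lstar_dual ccs_star (ccs_conj A))
          (conj_dual ccs_conj (rstar_dual ccs_star A))
      ≫ fmap ccs_conj (ccs_cyclor A)^-1
}.

(* [fmap dag] consumes maps of [op X]; the annotations [@hom X] present them as
   maps of [X], so that [fmap dag (f : @hom X A B)] has type [hom (dag B) (dag A)]. *)
Record dagger (X : LDC) := Dagger {
  dag :> functor (op X) X;
  lamT : forall A B : X, iso (dag A ⊗ dag B) (dag (A ⊕ B));
  lamP : forall A B : X, iso (dag A ⊕ dag B) (dag (A ⊗ B));
  lamtop : iso ⊤ (dag ⊥);
  lambot : iso ⊥ (dag ⊤);
  iota : forall A : X, iso A (dag (dag A));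
  lamT_nat : forall (A A' B B' : X) (f : @hom X A A') (g : @hom X B B'),
    fmap dag f ⊗₁ fmap dag g ≫ lamT A B = lamT A' B' ≫ fmap dag (f ⊕₁ g);
  lamP_nat : forall (A A' B B' : X) (f : @hom X A A') (g : @hom X B B'),
    fmap dag f ⊕₁ fmap dag g ≫ lamP A B = lamP A' B' ≫ fmap dag (f ⊗₁ g);
  iota_nat : forall (A B : X) (f : @hom X A B),
    f ≫ iota B = iota A ≫ fmap dag (fmap dag f);
  lamT_assoc : forall A B C : X,
    𝟙 ⊗₁ lamT B C ≫ lamT A (B ⊕ C) ≫ fmap dag (aP A B C : @hom X _ _)
    = (aT (dag A) (dag B) (dag C))^-1 ≫ lamT A B ⊗₁ 𝟙 ≫ lamT (A ⊕ B) C;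
  lamP_assoc : forall A B C : X,
    𝟙 ⊕₁ lamP B C ≫ lamP A (B ⊗ C) ≫ fmap dag (aT A B C : @hom X _ _)
    = (aP (dag A) (dag B) (dag C))^-1 ≫ lamP A B ⊕₁ 𝟙 ≫ lamP (A ⊗ B) C;
  lamT_unitl : forall A : X,
    lamtop ⊗₁ 𝟙 ≫ lamT ⊥ A = uLT (dag A) ≫ fmap dag (uLP A : @hom X _ _);
  lamT_unitr : forall A : X,
    𝟙 ⊗₁ lamtop ≫ lamT A ⊥ = uRT (dag A) ≫ fmap dag (uRP A : @hom X _ _);
  lamP_unitl : forall A : X,
    lambot ⊕₁ 𝟙 ≫ lamP ⊤ A = uLP (dag A) ≫ fmap dag (uLT A : @hom X _ _);
  lamP_unitr : forall A : X,
    𝟙 ⊕₁ lambot ≫ lamP A ⊤ = uRP (dag A) ≫ fmap dag (uRT A : @hom X _ _);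
  dag_dL : forall A B C : X,
    dL (dag A) (dag B) (dag C) ≫ lamT A B ⊕₁ 𝟙 ≫ lamP (A ⊕ B) C
    = 𝟙 ⊗₁ lamP B C ≫ lamT A (B ⊗ C) ≫ fmap dag (dR C A B);
  dag_dR : forall A B C : X,
    dR (dag A) (dag B) (dag C) ≫ 𝟙 ⊕₁ lamT C A ≫ lamP B (C ⊕ A)
    = lamP B C ⊗₁ 𝟙 ≫ lamT (B ⊗ C) A ≫ fmap dag (dL B C A);
  iota_par : forall A B : X,
    iota (A ⊕ B) ≫ fmap dag (lamT A B : @hom X _ _)
    = iota A ⊕₁ iota B ≫ lamP (dag A) (dag B);
  iota_tensor : forall A B : X,
    iota (A ⊗ B) ≫ fmap dag (lamP A B : @hom X _ _)
    = iota A ⊗₁ iota B ≫ lamT (dag A) (dag B);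
  iota_bot : iota ⊥ ≫ fmap dag (lamtop : @hom X _ _) = lambot;
  iota_top : iota ⊤ ≫ fmap dag (lambot : @hom X _ _) = lamtop;
  iota_dag : forall A : X,
    iota (dag A) = fmap dag (iota A)^-1 :> hom (dag A) (dag (dag (dag A)))
}.

Record dagger_star_autonomous (X : LDC) := DaggerStarAut {
  dsa_star : star_autonomous X;
  dsa_dagger : dagger X
}.

(* Main.v *)
From Corelib Require Import ssreflect ssrfun ssrbool.
Require Import Defs.

Set Implicit Arguments.
Unset Strict Implicit.
Unset Printing Implicit Defensive.
Local Open Scope cat_scope.

(** Write [K] for the conjugation and [L A] for the chosen left dual of [A].  The
    dagger is [A† := K (L A)].

    The reason this works is that [A†] represents sesquilinear pairings.  Since
    [K (A†) ≅ L A] is left dual to [A], a map [f : Y -> A†] is the same thing as a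
    pairing [A ⊗ K Y -> ⊥], namely [K f] followed by a universal pairing
    [ev_A : A ⊗ K (A†) -> ⊥] ([represent], [represent_ev], [represent_inj]);
    and if the pairing exhibits [K Y] as a left dual of [A], the map it represents
    is an isomorphism ([represent_iso]).  Every structure map of the dagger is
    defined as the map represented by an evident pairing, and every axiom becomes
    an equality of two pairings:

    - [λ_⊗ : A† ⊗ B† -> (A ⊕ B)†] is represented by the nested evaluation of [A ⊕ B]
      against [K (B†) ⊗ K (A†)] ([par_pairing]), and [λ_⊕] by that of [A ⊗ B]
      against [K (B†) ⊕ K (A†)] ([tensor_pairing]).  These nestings make sense for
      arbitrary pairings in a linearly distributive category, where they are
      associative and unital and are exchanged by the linear distributors
      ([par_pairing_assoc], [tensor_pairing_assoc], [dR_pairing], [dL_pairing]).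
      The associativity, unit and distributor axioms follow by inserting the
      compatibility of [χ_⊗] and [χ_⊕] with associators, unitors and distributors.

    - [ι : A -> A††] is represented by the transpose of [ev_A].  Conjugation turns a
      pairing [p : A ⊗ K Y -> ⊥] into [p^t : Y ⊗ K A -> ⊥] ([transpose]).  This
      operation is involutive ([transposeK]), because [χ], [ε] and the comparison
      [⊥ ≅ K ⊥] are; and it exchanges the two nestings
      ([transpose_par_pairing]).  Compatibility of [ι] with the [λ]s says exactly
      this, and [ι_(A†) = (ι_A^-1)†] is the triangle identity of the self-adjunction
      [hom (Y, A†) ≅ hom (A, Y†)], that is, [ev_A^tt = ev_A]. *)

(** * Monoidal coherence *)

Lemma mmap_split (C : category) (M : monoidal C) (A A' B B' : C)
    (f : hom A A') (g : hom B B') :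
  mmap M f g = mmap M 𝟙 g ≫ mmap M f 𝟙.
Proof. by rewrite -mmap_comp comp_idl comp_idr. Qed.

Section Pentagon.
Variables (C : category) (M : monoidal C).

Lemma mpentagon_inv (A B D E : C) :
  mmap M (idm A) (massoc M B D E)^-1 ≫ (massoc M A (mob M B D) E)^-1
    ≫ mmap M (massoc M A B D)^-1 (idm E)
  = (massoc M A B (mob M D E))^-1 ≫ (massoc M (mob M A B) D E)^-1.
Proof.
apply: (iso_mono (i := massoc M (mob M A B) D E)).
rewrite !comp_assoc iso_invK comp_idr.
apply: (iso_mono (i := massoc M A B (mob M D E))).
rewrite iso_invK !comp_assoc -mpentagon (ra (esym (mmap_compl _ _ _ _))) iso_invK.
rewrite mmap_id comp_idl (ra (iso_invK _)) comp_idl -mmap_compr iso_invK.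
exact: mmap_id.
Qed.

Lemma mpentagon_mid (A B D E : C) :
  massoc M A B (mob M D E) ≫ mmap M (idm A) (massoc M B D E)^-1
  = (massoc M (mob M A B) D E)^-1 ≫ mmap M (massoc M A B D) (idm E)
    ≫ massoc M A (mob M B D) E.
Proof.
apply: (iso_epi (i := massoc M (mob M A B) D E)).
rewrite (ra (iso_morK _)) comp_idl (ra (esym (mpentagon _ _ _ _ _))) !comp_assoc.
by rewrite -mmap_compr iso_morK mmap_id comp_idr.
Qed.

End Pentagon.

(** * Nested pairings in a linearly distributive category *)

Section Pairings.
Variable X : LDC.

(** Evaluating the summand next to the argument; [contrR] and [contrL] are the inner
    step of the two nested evaluations below. *)
Definition contrR (A B Q : X) (q : hom (B ⊗ Q) ⊥) : hom ((A ⊕ B) ⊗ Q) A :=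
  dR Q A B ≫ 𝟙 ⊕₁ q ≫ uRP A.

Definition contrL (B Q P : X) (q : hom (B ⊗ Q) ⊥) : hom (B ⊗ (Q ⊕ P)) P :=
  dL B Q P ≫ q ⊕₁ 𝟙 ≫ uLP P.

(** For the evaluations of dual objects, these are the counits [tensor_par_eps] and
    [par_tensor_eps]; all their coherence holds before any duality is assumed. *)
Definition par_pairing (A B P Q : X) (p : hom (A ⊗ P) ⊥) (q : hom (B ⊗ Q) ⊥) :
    hom ((A ⊕ B) ⊗ (Q ⊗ P)) ⊥ :=
  (aT (A ⊕ B) Q P)^-1 ≫ contrR A q ⊗₁ 𝟙 ≫ p.

Definition tensor_pairing (A B P Q : X) (p : hom (A ⊗ P) ⊥) (q : hom (B ⊗ Q) ⊥) :
    hom ((A ⊗ B) ⊗ (Q ⊕ P)) ⊥ :=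
  aT A B (Q ⊕ P) ≫ 𝟙 ⊗₁ contrL P q ≫ p.

Lemma contrR_nat (A A' B B' Q Q' : X) (f : hom A A') (g : hom B B')
    (g' : hom Q Q') (q : hom (B' ⊗ Q') ⊥) :
  (f ⊕₁ g) ⊗₁ g' ≫ contrR A' q = contrR A (g ⊗₁ g' ≫ q) ≫ f.
Proof.
rewrite /contrR (ra (dR_nat _ _ _)) !comp_assoc -mrunit_nat.
by rewrite !(ra (esym (mmap_comp _ _ _ _ _))) comp_idl !comp_idr.
Qed.

Lemma contrL_nat (B B' P P' Q Q' : X) (f : hom P P') (g : hom B B')
    (g' : hom Q Q') (q : hom (B' ⊗ Q') ⊥) :
  g ⊗₁ (g' ⊕₁ f) ≫ contrL P' q = contrL P (g ⊗₁ g' ≫ q) ≫ f.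
Proof.
rewrite /contrL (ra (dL_nat _ _ _)) !comp_assoc -mlunit_nat.
by rewrite !(ra (esym (mmap_comp _ _ _ _ _))) comp_idl !comp_idr.
Qed.

Lemma par_pairing_nat (A A' B B' P P' Q Q' : X) (f : hom A A') (f' : hom P P')
    (g : hom B B') (g' : hom Q Q') (p : hom (A' ⊗ P') ⊥) (q : hom (B' ⊗ Q') ⊥) :
  (f ⊕₁ g) ⊗₁ (g' ⊗₁ f') ≫ par_pairing p q
  = par_pairing (f ⊗₁ f' ≫ p) (g ⊗₁ g' ≫ q).
Proof.
rewrite /par_pairing (ra (esym (massoc_inv_nat _ _ _ _))) !comp_assoc.
congr (_ ≫ _); rewrite !(ra (esym (mmap_comp _ _ _ _ _))).
by rewrite contrR_nat comp_idl !comp_idr.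
Qed.

Lemma tensor_pairing_nat (A A' B B' P P' Q Q' : X) (f : hom A A') (f' : hom P P')
    (g : hom B B') (g' : hom Q Q') (p : hom (A' ⊗ P') ⊥) (q : hom (B' ⊗ Q') ⊥) :
  (f ⊗₁ g) ⊗₁ (g' ⊕₁ f') ≫ tensor_pairing p q
  = tensor_pairing (f ⊗₁ f' ≫ p) (g ⊗₁ g' ≫ q).
Proof.
rewrite /tensor_pairing (ra (massoc_nat _ _ _ _)) !comp_assoc.
congr (_ ≫ _); rewrite !(ra (esym (mmap_comp _ _ _ _ _))).
by rewrite contrL_nat comp_idl !comp_idr.
Qed.

Lemma contrR_natl (A B B' Q : X) (g : hom B B') (q : hom (B' ⊗ Q) ⊥) :
  contrR A (g ⊗₁ 𝟙 ≫ q) = (𝟙 ⊕₁ g) ⊗₁ 𝟙 ≫ contrR A q.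
Proof. by rewrite contrR_nat comp_idr. Qed.

Lemma contrL_natr (B Q Q' P : X) (g : hom Q Q') (q : hom (B ⊗ Q') ⊥) :
  contrL P (𝟙 ⊗₁ g ≫ q) = 𝟙 ⊗₁ (g ⊕₁ 𝟙) ≫ contrL P q.
Proof. by rewrite contrL_nat comp_idr. Qed.

Lemma contrR_natr (A B Q Q' : X) (g : hom Q Q') (q : hom (B ⊗ Q') ⊥) :
  contrR A (𝟙 ⊗₁ g ≫ q) = 𝟙 ⊗₁ g ≫ contrR A q.
Proof. by rewrite -(mmap_id par A B) contrR_nat comp_idr. Qed.

Lemma contrL_natl (B B' Q P : X) (g : hom B B') (q : hom (B' ⊗ Q) ⊥) :
  contrL P (g ⊗₁ 𝟙 ≫ q) = g ⊗₁ 𝟙 ≫ contrL P q.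
Proof. by rewrite -(mmap_id par Q P) contrL_nat comp_idr. Qed.

Lemma contrR_aT_inv (A C Q R : X) (h : hom ((C ⊗ R) ⊗ Q) ⊥) :
  contrR A ((aT C R Q)^-1 ≫ h)
  = (aT (A ⊕ C) R Q)^-1 ≫ dR R A C ⊗₁ 𝟙 ≫ contrR A h.
Proof.
by rewrite /contrR mmap_compr !comp_assoc (ra (dR_aT_inv _ _ _ _)) !comp_assoc.
Qed.

Lemma contrR_aT (A C Q R : X) (h : hom (C ⊗ (R ⊗ Q)) ⊥) :
  dR R A C ⊗₁ 𝟙 ≫ contrR A (aT C R Q ≫ h) = aT (A ⊕ C) R Q ≫ contrR A h.
Proof.
by rewrite /contrR mmap_compr !comp_assoc (ra (dR_aT _ _ _ _)) !comp_assoc.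
Qed.

Lemma contrL_aT (B C Q P : X) (h : hom (B ⊗ (C ⊗ Q)) ⊥) :
  contrL P (aT B C Q ≫ h) = aT B C (Q ⊕ P) ≫ 𝟙 ⊗₁ dL C Q P ≫ contrL P h.
Proof.
by rewrite /contrL mmap_compl !comp_assoc (ra3 (dL_aT _ _ _ _)) !comp_assoc.
Qed.

Lemma contrL_aT_inv (B C Q P : X) (h : hom ((B ⊗ C) ⊗ Q) ⊥) :
  𝟙 ⊗₁ dL C Q P ≫ contrL P ((aT B C Q)^-1 ≫ h)
  = (aT B C (Q ⊕ P))^-1 ≫ contrL P h.
Proof.
by rewrite /contrL mmap_compl !comp_assoc (ra3 (dL_aT_inv _ _ _ _)) !comp_assoc.
Qed.

Lemma contrR_aP (A B C R : X) (r : hom (C ⊗ R) ⊥) :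
  aP A B C ⊗₁ 𝟙 ≫ dR R A (B ⊕ C) ≫ 𝟙 ⊕₁ contrR B r = contrR (A ⊕ B) r.
Proof.
rewrite /contrR !mmap_compr (ra3 (dR_aP _ _ _ _)) !comp_assoc.
rewrite -(mrunit_assoc par) -(mmap_id par A B) (ra (massoc_nat _ _ _ _)).
by rewrite !comp_assoc.
Qed.

Lemma contrL_aP (A B C R : X) (r : hom (C ⊗ R) ⊥) :
  𝟙 ⊗₁ (aP R A B)^-1 ≫ dL C (R ⊕ A) B ≫ contrL A r ⊕₁ 𝟙 = contrL (A ⊕ B) r.
Proof.
rewrite /contrL !mmap_compl (ra3 (dL_aP_inv _ _ _ _)) !comp_assoc.
rewrite -(mlunit_assoc' par) -(mmap_id par A B) (ra (massoc_inv_nat _ _ _ _)).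
by rewrite !comp_assoc.
Qed.

Lemma contrR_dL (A B C R : X) (r : hom (C ⊗ R) ⊥) :
  dL A B C ⊗₁ 𝟙 ≫ contrR (A ⊗ B) r = aT A (B ⊕ C) R ≫ 𝟙 ⊗₁ contrR B r.
Proof.
rewrite /contrR (ra (esym (dLR_aT _ _ _ _))) -(mmap_id tensor A B) !comp_assoc.
by rewrite (ra (esym (dL_nat _ _ _))) !comp_assoc dL_uRP !mmap_compr.
Qed.

Lemma contrL_dR (A B C R : X) (r : hom (C ⊗ R) ⊥) :
  𝟙 ⊗₁ dR B R A ≫ contrL (A ⊗ B) r = (aT C (R ⊕ A) B)^-1 ≫ contrL A r ⊗₁ 𝟙.
Proof.
rewrite /contrL (ra (dLR_aT_inv _ _ _ _)) -(mmap_id tensor A B) !comp_assoc.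
by rewrite (ra (esym (dR_nat _ _ _))) !comp_assoc dR_uLP !mmap_compl.
Qed.

Lemma par_pairing_natl (A B P P' Q : X) (f : hom P P') (p : hom (A ⊗ P') ⊥)
    (q : hom (B ⊗ Q) ⊥) :
  par_pairing (𝟙 ⊗₁ f ≫ p) q = 𝟙 ⊗₁ (𝟙 ⊗₁ f) ≫ par_pairing p q.
Proof. by rewrite -(mmap_id par) par_pairing_nat mmap_id comp_idl. Qed.

Lemma par_pairing_natr (A B P Q Q' : X) (g : hom Q Q') (p : hom (A ⊗ P) ⊥)
    (q : hom (B ⊗ Q') ⊥) :
  par_pairing p (𝟙 ⊗₁ g ≫ q) = 𝟙 ⊗₁ (g ⊗₁ 𝟙) ≫ par_pairing p q.
Proof. by rewrite -(mmap_id par) par_pairing_nat mmap_id comp_idl. Qed.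

Lemma tensor_pairing_natl (A B P P' Q : X) (f : hom P P') (p : hom (A ⊗ P') ⊥)
    (q : hom (B ⊗ Q) ⊥) :
  tensor_pairing (𝟙 ⊗₁ f ≫ p) q = 𝟙 ⊗₁ (𝟙 ⊕₁ f) ≫ tensor_pairing p q.
Proof. by rewrite -(mmap_id tensor A) tensor_pairing_nat mmap_id comp_idl. Qed.

Lemma tensor_pairing_natr (A B P Q Q' : X) (g : hom Q Q') (p : hom (A ⊗ P) ⊥)
    (q : hom (B ⊗ Q') ⊥) :
  tensor_pairing p (𝟙 ⊗₁ g ≫ q) = 𝟙 ⊗₁ (g ⊕₁ 𝟙) ≫ tensor_pairing p q.
Proof. by rewrite -(mmap_id tensor A) tensor_pairing_nat mmap_id comp_idl. Qed.

(** The step that reduces associativity of nesting to the pentagon. *)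
Lemma contrR_par (A B C Q R : X) (q : hom (B ⊗ Q) ⊥) (r : hom (C ⊗ R) ⊥) :
  aP A B C ⊗₁ 𝟙 ≫ contrR A (par_pairing q r)
  = (aT ((A ⊕ B) ⊕ C) R Q)^-1 ≫ contrR (A ⊕ B) r ⊗₁ 𝟙 ≫ contrR A q.
Proof.
rewrite /par_pairing contrR_aT_inv contrR_natl -(mmap_id _ R Q).
rewrite (ra (esym (massoc_inv_nat _ _ _ _))) !comp_assoc.
by rewrite -(contrR_aP A B) !mmap_compl !comp_assoc.
Qed.

Lemma contrL_tensor (B C P Q R : X) (q : hom (B ⊗ Q) ⊥) (r : hom (C ⊗ R) ⊥) :
  𝟙 ⊗₁ (aP R Q P)^-1 ≫ contrL P (tensor_pairing q r)
  = aT B C (R ⊕ (Q ⊕ P)) ≫ 𝟙 ⊗₁ contrL (Q ⊕ P) r ≫ contrL P q.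
Proof.
rewrite /tensor_pairing contrL_aT contrL_natr -(mmap_id _ B C).
rewrite (ra (massoc_nat _ _ _ _)) !comp_assoc.
by rewrite -(contrL_aP Q P) !mmap_compr !comp_assoc.
Qed.

Lemma par_pairing_assoc (A B C P Q R : X) (p : hom (A ⊗ P) ⊥) (q : hom (B ⊗ Q) ⊥)
    (r : hom (C ⊗ R) ⊥) :
  aP A B C ⊗₁ (aT R Q P)^-1 ≫ par_pairing p (par_pairing q r)
  = par_pairing (par_pairing p q) r.
Proof.
rewrite /par_pairing -/(par_pairing q r).
rewrite -[aP A B C : hom _ _]comp_idl -[(aT R Q P)^-1]comp_idr mmap_comp !comp_assoc.
rewrite -(mmap_id tensor (R ⊗ Q) P) (ra (esym (massoc_inv_nat _ _ _ _))) !comp_assoc.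
rewrite (ra (esym (mmap_compl _ _ _ _))) contrR_par.
move: (contrR (A ⊕ B) r) (contrR A q) => cr cq; rewrite !mmap_compl !comp_assoc.
rewrite -(mmap_id tensor Q P) (ra (esym (massoc_inv_nat _ _ _ _))) !comp_assoc.
by rewrite (ra (esym (mpentagon_inv _ _ _ _ _))) !comp_assoc.
Qed.

Lemma tensor_pairing_assoc (A B C P Q R : X) (p : hom (A ⊗ P) ⊥) (q : hom (B ⊗ Q) ⊥)
    (r : hom (C ⊗ R) ⊥) :
  aT A B C ⊗₁ (aP R Q P)^-1 ≫ tensor_pairing p (tensor_pairing q r)
  = tensor_pairing (tensor_pairing p q) r.
Proof.
rewrite /tensor_pairing -/(tensor_pairing q r).
rewrite -[aT A B C : hom _ _]comp_idr -[(aP R Q P)^-1]comp_idl mmap_comp !comp_assoc.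
rewrite -(mmap_id tensor A (B ⊗ C)) (ra (massoc_nat _ _ _ _)) !comp_assoc.
rewrite (ra (esym (mmap_compr _ _ _ _))) contrL_tensor.
move: (contrL (Q ⊕ P) r) (contrL P q) => cr cq; rewrite !mmap_compr !comp_assoc.
rewrite -(mmap_id tensor A B) (ra (massoc_nat _ _ _ _)) !comp_assoc.
by rewrite (ra3 (mpentagon _ _ _ _ _)) !comp_assoc.
Qed.

(** Both sides evaluate [C] against [R], then [B] against [Q], then [A] against [P];
    the mixed associativity of the two distributors lets the inner evaluations be
    moved past each other, and what remains is the pentagon. *)
Lemma dR_pairing (A B C P Q R : X) (p : hom (A ⊗ P) ⊥) (q : hom (B ⊗ Q) ⊥)
    (r : hom (C ⊗ R) ⊥) :
  𝟙 ⊗₁ dR P R Q ≫ tensor_pairing (par_pairing p q) r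
  = dR C A B ⊗₁ 𝟙 ≫ par_pairing p (tensor_pairing q r).
Proof.
rewrite /par_pairing -(mmap_id tensor (R ⊕ Q) P).
rewrite (ra (esym (massoc_inv_nat _ _ _ _))) !comp_assoc.
rewrite (ra (esym (mmap_compl _ _ _ _))) contrR_aT contrR_natr.
rewrite /tensor_pairing.
rewrite -(mmap_id tensor (A ⊕ B) C) (ra (massoc_nat _ _ _ _)) !comp_assoc.
rewrite (ra (esym (mmap_compr _ _ _ _))) contrL_dR.
move: (contrL Q r) (contrR A q) => cr cq; rewrite !mmap_compl !mmap_compr !comp_assoc.
rewrite (ra (esym (massoc_inv_nat _ _ _ _))) !comp_assoc.
by rewrite (ra (mpentagon_mid _ _ _ _ _)) !comp_assoc (ra (iso_morK _)) comp_idl.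
Qed.

Lemma dL_pairing (A B C P Q R : X) (p : hom (A ⊗ P) ⊥) (q : hom (B ⊗ Q) ⊥)
    (r : hom (C ⊗ R) ⊥) :
  𝟙 ⊗₁ dL R Q P ≫ tensor_pairing p (par_pairing q r)
  = dL A B C ⊗₁ 𝟙 ≫ par_pairing (tensor_pairing p q) r.
Proof.
rewrite /tensor_pairing -(mmap_id tensor A (B ⊕ C)).
rewrite (ra (massoc_nat _ _ _ _)) !comp_assoc.
rewrite (ra (esym (mmap_compr _ _ _ _))) contrL_aT_inv contrL_natl.
rewrite /par_pairing.
rewrite -(mmap_id tensor R (Q ⊕ P)) (ra (esym (massoc_inv_nat _ _ _ _))) !comp_assoc.
rewrite (ra (esym (mmap_compl _ _ _ _))) contrR_dL.
move: (contrL P q) (contrR B r) => cq cr; rewrite !mmap_compl !mmap_compr !comp_assoc.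
rewrite (ra (massoc_nat _ _ _ _)) !comp_assoc.
by rewrite (ra (mpentagon_mid _ _ _ _ _)) !comp_assoc.
Qed.

Lemma par_pairing_unitl (B Q : X) (q : hom (B ⊗ Q) ⊥) :
  par_pairing (uRT ⊥ : hom (⊥ ⊗ ⊤) ⊥) q = uLP B ⊗₁ uRT Q ≫ q.
Proof.
rewrite /par_pairing mrunit_nat -comp_assoc mrunit_assoc' /contrR.
rewrite -(munit_unitors par) mlunit_nat (ra (dR_uLP _ _)) -comp_assoc.
by rewrite -mmap_comp comp_idl comp_idr.
Qed.

Lemma par_pairing_unitr (A P : X) (p : hom (A ⊗ P) ⊥) :
  par_pairing p (uRT ⊥ : hom (⊥ ⊗ ⊤) ⊥) = uRP A ⊗₁ uLT P ≫ p.
Proof.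
rewrite /par_pairing /contrR (ra (dR_uRT _ _)) mmap_compl -mtriangle !comp_assoc.
rewrite (ra (iso_invK _)) comp_idl -comp_assoc.
by rewrite -mmap_comp comp_idl comp_idr.
Qed.

Lemma tensor_pairing_unitl (B Q : X) (q : hom (B ⊗ Q) ⊥) :
  tensor_pairing (uLT ⊥ : hom (⊤ ⊗ ⊥) ⊥) q = uLT B ⊗₁ uRP Q ≫ q.
Proof.
rewrite /tensor_pairing mlunit_nat -comp_assoc mlunit_assoc /contrL.
rewrite (munit_unitors par) mrunit_nat (ra (dL_uRP _ _)) -comp_assoc.
by rewrite -mmap_comp comp_idl comp_idr.
Qed.

Lemma tensor_pairing_unitr (A P : X) (p : hom (A ⊗ P) ⊥) :
  tensor_pairing p (uLT ⊥ : hom (⊤ ⊗ ⊥) ⊥) = uRT A ⊗₁ uLP P ≫ p.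
Proof.
rewrite /tensor_pairing /contrL (ra (dL_uLT _ _)) mmap_compr !comp_assoc.
rewrite (ra (mtriangle _ _ _)) -comp_assoc.
by rewrite -mmap_comp comp_idl comp_idr.
Qed.

End Pairings.

(** * Universality of the pairing of a dual *)

Section Mates.
Variable X : LDC.

(** The canonical comparison [left_dual_iso d' d] is the case [p := eps d']. *)
Definition mate (A B Y : X) (d : linear_dual B A) (p : hom (A ⊗ Y) ⊥) : hom Y B :=
  (uLT Y)^-1 ≫ eta d ⊗₁ 𝟙 ≫ dR Y B A ≫ 𝟙 ⊕₁ p ≫ uRP B.

(** Sliding [p] to the end of the composite leaves the zigzag at [A]. *)
Lemma mate_eps (A B Y : X) (d : linear_dual B A) (p : hom (A ⊗ Y) ⊥) :
  𝟙 ⊗₁ mate d p ≫ eps d = p.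
Proof.
rewrite /mate !mmap_compr -dL_uRP !comp_assoc -mrunit_nat.
rewrite (ra (dL_nat _ _ _)) mmap_id !comp_assoc (ra (mmap_swap _ _ _)).
rewrite !comp_assoc -(munit_unitors par) mlunit_nat.
rewrite (ra (dLR_aT_inv _ _ _ _)) !comp_assoc.
rewrite -(mmap_id tensor A Y) (ra (esym (dR_nat _ _ _))) !comp_assoc (ra (dR_uLP _ _)).
rewrite (ra (esym (massoc_inv_nat _ _ _ _))) !comp_assoc (ra (mtriangle_inv' _ _ _)).
rewrite !(ra (esym (mmap_compl _ _ _ _))).
by rewrite !comp_assoc dual_zigzag_right mmap_id comp_idl.
Qed.

Lemma mate_of_eps (A B Y : X) (d : linear_dual B A) (g : hom Y B) :
  mate d (𝟙 ⊗₁ g ≫ eps d) = g.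
Proof.
rewrite /mate mmap_compr !comp_assoc (ra (esym (dR_natr _ _ _))) !comp_assoc.
rewrite (ra (esym (mmap_swap _ _ _))).
rewrite !comp_assoc (ra (mlunit_inv_nat _ _)) !comp_assoc.
by rewrite dual_zigzag_left comp_idr.
Qed.

Lemma mate_inj (A B Y : X) (d : linear_dual B A) (f g : hom Y B) :
  𝟙 ⊗₁ f ≫ eps d = 𝟙 ⊗₁ g ≫ eps d -> f = g.
Proof. by move=> e; rewrite -(mate_of_eps d f) e mate_of_eps. Qed.

Section Transport.
Variables (A A' B B' : X) (d : linear_dual B A) (i : iso B' B) (j : iso A' A).

Lemma transport_zigzag_left :
  (uLT B')^-1 ≫ (eta d ≫ i^-1 ⊕₁ j^-1) ⊗₁ 𝟙 ≫ dR B' B' A'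
    ≫ 𝟙 ⊕₁ (j ⊗₁ i ≫ eps d) ≫ uRP B' = 𝟙.
Proof.
rewrite mmap_compl !comp_assoc (ra (dR_nat _ _ _)) !comp_assoc.
have -> : i^-1 ⊕₁ (j^-1 ⊗₁ 𝟙) ≫ 𝟙 ⊕₁ (j ⊗₁ i ≫ eps d) ≫ uRP B'
    = 𝟙 ⊕₁ (𝟙 ⊗₁ i) ≫ 𝟙 ⊕₁ eps d ≫ uRP B ≫ i^-1.
  rewrite -mrunit_nat !(ra (esym (mmap_comp _ _ _ _ _))) !comp_idl.
  by rewrite iso_invK !comp_idr.
rewrite (ra (esym (dR_natr _ _ _))) !comp_assoc (ra (esym (mmap_swap _ _ _))).
rewrite !comp_assoc (ra (mlunit_inv_nat _ _)) !comp_assoc.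
rewrite -[RHS](iso_morK i) -[in RHS](comp_idl i^-1) -[in RHS](dual_zigzag_left d).
by rewrite !comp_assoc.
Qed.

Lemma transport_zigzag_right :
  (uRT A')^-1 ≫ 𝟙 ⊗₁ (eta d ≫ i^-1 ⊕₁ j^-1) ≫ dL A' B' A'
    ≫ (j ⊗₁ i ≫ eps d) ⊕₁ 𝟙 ≫ uLP A' = 𝟙.
Proof.
rewrite mmap_compr !comp_assoc (ra (dL_nat _ _ _)) !comp_assoc.
have -> : (𝟙 ⊗₁ i^-1) ⊕₁ j^-1 ≫ (j ⊗₁ i ≫ eps d) ⊕₁ 𝟙 ≫ uLP A'
    = (j ⊗₁ 𝟙) ⊕₁ 𝟙 ≫ eps d ⊕₁ 𝟙 ≫ uLP A ≫ j^-1.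
  rewrite -mlunit_nat !(ra (esym (mmap_comp _ _ _ _ _))) !comp_idl.
  by rewrite iso_invK !comp_idr.
rewrite (ra (esym (dL_natl _ _ _))) !comp_assoc (ra (mmap_swap _ _ _)).
rewrite !comp_assoc (ra (mrunit_inv_nat _ _)) !comp_assoc.
rewrite -[RHS](iso_morK j) -[in RHS](comp_idl j^-1) -[in RHS](dual_zigzag_right d).
by rewrite !comp_assoc.
Qed.

Definition dual_transport : linear_dual B' A' :=
  LinearDual transport_zigzag_left transport_zigzag_right.
End Transport.
End Mates.

(** * Anti-monoidal involutions *)

Section ConjMonoidalInverse.
Variables (C : category) (M : monoidal C) (F : functor C C).
Variable e : forall A : C, iso (F (F A)) A.
Variable chi : forall A B : C, iso (mob M (F A) (F B)) (F (mob M B A)).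
Hypothesis e_nat : forall (A B : C) (f : hom A B),
  fmap F (fmap F f) ≫ e B = e A ≫ f.
Hypothesis e_conj : forall A : C, fmap F (e A) = e (F A).
Hypothesis chiM : conj_monoidal e chi.
Local Notation u := (conj_unit_iso (M := M) e chi).

(** It suffices to check that the composite [v] satisfies [v ⊗ 1 = 1], and this may
    be tested after precomposition with [1 ⊗ ε].  The involution law then writes
    [ε ⊗ ε] in terms of [χ], and the two unit comparisons cancel against the left
    and right unit laws for [χ]. *)
Lemma conj_unit_involutive : u ≫ fmap F u ≫ e (munit M) = 𝟙.
Proof.
move: (conj_unit_left e_nat e_conj chiM) (conj_unit_right e_nat e_conj chiM) => /=.
(* Abstracting the unit keeps the rewriting below from unfolding it. *)
move: (conj_unit e chi) => v left_unit right_unit.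
apply: (mmap_unit_inj (M := M)).
apply: (iso_epi (i := miso M (idiso _) (e (munit M)))) => /=.
rewrite mmap_id comp_idr.
rewrite mmap_swap !mmap_compl !comp_assoc -mmap_comp comp_idr comp_idl.
rewrite -(chi_eps chiM) (ra (chi_natl chiM _ _)) !comp_assoc (ra (left_unit _)).
rewrite !comp_assoc !(ra (esym (fmap_comp _ _ _))) !comp_assoc right_unit.
rewrite (ra (iso_invK _)) comp_idl e_nat (ra (esym (mlunit_nat _ _))).
by rewrite !comp_assoc iso_morK comp_idr.
Qed.

Lemma conj_unit_inv_involutive : fmap F u^-1 ≫ u^-1 = e (munit M).
Proof.
move: u conj_unit_involutive => v ve.
rewrite -[v^-1 in X in _ ≫ X]comp_idr -ve (ra (iso_invK _)) comp_idl.
by rewrite (ra (esym (fmap_comp _ _ _))) iso_invK fmap_id comp_idl.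
Qed.

Lemma chi_assoc_inv (A B D : C) :
  fmap F (massoc M D B A)^-1 ≫ (chi A (mob M D B))^-1 ≫ mmap M 𝟙 (chi B D)^-1
    ≫ (massoc M (F A) (F B) (F D))^-1
  = (chi (mob M B A) D)^-1 ≫ mmap M (chi A B)^-1 𝟙.
Proof.
apply: (iso_mono (i := massoc M (F A) (F B) (F D))).
apply: (iso_mono (i := miso M (idiso (F A)) (chi B D))).
apply: (iso_mono (i := chi A (mob M D B))) => /=.
rewrite !comp_assoc (ra (iso_invK _)) comp_idl.
rewrite (ra (esym (mmap_compr _ _ _ _))) iso_invK mmap_id comp_idl iso_invK comp_idr.
rewrite (chi_assoc chiM) (ra (esym (mmap_compl _ _ _ _))) iso_invK mmap_id.
by rewrite comp_idl (ra (iso_invK _)) comp_idl.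
Qed.

End ConjMonoidalInverse.

(** * Conjugation and its inverse forms *)

Section Conjugation.
Variables (X : LDC) (K : conjugation X).

Lemma conj_top_involutive : fmap K (conj_top K)^-1 ≫ (conj_top K)^-1 = cjeps K ⊤.
Proof.
exact: (conj_unit_inv_involutive (@cjeps_nat _ K) (@cjeps_conj _ K) (chiT_monoidal K)).
Qed.

Lemma conj_bot_involutive : fmap K (conj_bot K)^-1 ≫ (conj_bot K)^-1 = cjeps K ⊥.
Proof.
exact: (conj_unit_inv_involutive (@cjeps_nat _ K) (@cjeps_conj _ K) (chiP_monoidal K)).
Qed.

Lemma cjeps_inv_nat (A B : X) (f : hom A B) :
  (cjeps K A)^-1 ≫ fmap K (fmap K f) = f ≫ (cjeps K B)^-1.
Proof. by apply: iso_swapl; rewrite cjeps_nat. Qed.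

Lemma cjeps_inv_conj (A : X) : fmap K (cjeps K A)^-1 = (cjeps K (K A))^-1.
Proof.
apply: (iso_mono (i := cjeps K (K A))); rewrite iso_invK -cjeps_conj.
by rewrite -fmap_comp iso_invK fmap_id.
Qed.

Lemma conj_faithful (A B : X) (f g : hom A B) : fmap K f = fmap K g -> f = g.
Proof.
move=> h; apply: (iso_epi (i := cjeps K A)).
by rewrite -!cjeps_nat h.
Qed.

Lemma chiT_inv_nat (A B A' B' : X) (f : hom A A') (g : hom B B') :
  fmap K (g ⊗₁ f) ≫ (chiT K A' B')^-1 = (chiT K A B)^-1 ≫ fmap K f ⊗₁ fmap K g.
Proof. by symmetry; apply: iso_swapl; rewrite (chi_nat (chiT_monoidal K)). Qed.

Lemma conj_top_right_inv (A : X) :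
  (chiT K A ⊤)^-1 ≫ 𝟙 ⊗₁ (conj_top K)^-1 ≫ uRT (K A) = fmap K (uLT A).
Proof.
move: (conj_top K) (conj_top_right K A) => t et.
apply: (iso_epi (i := chiT K A ⊤)); rewrite (ra (iso_morK _)) comp_idl.
apply: (iso_epi (i := miso tensor (idiso (K A)) t)) => /=.
rewrite (ra (esym (mmap_compr _ _ _ _))) iso_morK mmap_id comp_idl (ra et).
by rewrite comp_assoc -fmap_comp iso_invK fmap_id comp_idr.
Qed.

Lemma conj_top_left_inv (A : X) :
  (chiT K ⊤ A)^-1 ≫ (conj_top K)^-1 ⊗₁ 𝟙 ≫ uLT (K A) = fmap K (uRT A).
Proof.
move: (conj_top K) (conj_top_left K A) => t et.
apply: (iso_epi (i := chiT K ⊤ A)); rewrite (ra (iso_morK _)) comp_idl.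
apply: (iso_epi (i := miso tensor t (idiso (K A)))) => /=.
rewrite (ra (esym (mmap_compl _ _ _ _))) iso_morK mmap_id comp_idl (ra et).
by rewrite comp_assoc -fmap_comp iso_invK fmap_id comp_idr.
Qed.

Lemma conj_dR_inv (A B C : X) :
  fmap K (dL A B C) ≫ chiP K (A ⊗ B) C ≫ 𝟙 ⊕₁ (chiT K B A)^-1
  = (chiT K (B ⊕ C) A)^-1 ≫ chiP K B C ⊗₁ 𝟙 ≫ dR (K A) (K C) (K B).
Proof.
apply: (iso_epi (i := chiT K (B ⊕ C) A)); rewrite (ra (iso_morK _)) comp_idl.
rewrite (ra3 (esym (conj_dR _ _ _ _))) !comp_assoc -mmap_compr iso_morK.
by rewrite mmap_id comp_idr.
Qed.

Lemma conj_dL_inv (A B C : X) :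
  fmap K (dR A C B) ≫ chiP K C (B ⊗ A) ≫ (chiT K A B)^-1 ⊕₁ 𝟙
  = (chiT K A (C ⊕ B))^-1 ≫ 𝟙 ⊗₁ chiP K C B ≫ dL (K A) (K B) (K C).
Proof.
apply: (iso_epi (i := chiT K A (C ⊕ B))); rewrite (ra (iso_morK _)) comp_idl.
rewrite (ra3 (esym (conj_dL _ _ _ _))) !comp_assoc -mmap_compl iso_morK.
by rewrite mmap_id comp_idr.
Qed.

End Conjugation.

(** * Transposition of pairings *)

Section Transpose.
Variables (X : LDC) (K : conjugation X).

(** The pairing [(y, a) |-> conjugate of p (a, y)]. *)
Definition transpose (A Y : X) (p : hom (A ⊗ K Y) ⊥) : hom (Y ⊗ K A) ⊥ :=
  (cjeps K Y)^-1 ⊗₁ 𝟙 ≫ chiT K (K Y) A ≫ fmap K p ≫ (conj_bot K)^-1.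

Lemma transpose_nat (A A' Y Y' : X) (f : hom A A') (g : hom Y Y')
    (p : hom (A' ⊗ K Y') ⊥) :
  transpose (f ⊗₁ fmap K g ≫ p) = g ⊗₁ fmap K f ≫ transpose p.
Proof.
rewrite /transpose fmap_comp !comp_assoc (ra (esym (chi_nat (chiT_monoidal K) _ _))).
rewrite !comp_assoc !(ra (esym (mmap_comp _ _ _ _ _))).
by rewrite cjeps_inv_nat comp_idl comp_idr.
Qed.

Lemma transposeK (A Y : X) (p : hom (A ⊗ K Y) ⊥) : transpose (transpose p) = p.
Proof.
rewrite /transpose; move: (conj_bot K) (conj_bot_involutive K) => b bb.
rewrite !fmap_comp !comp_assoc bb cjeps_nat.
rewrite (ra (esym (chi_nat (chiT_monoidal K) _ _))) !comp_assoc.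
rewrite (ra3 (chi_eps (chiT_monoidal K) _ _)) cjeps_inv_conj fmap_id.
rewrite !(ra (esym (mmap_comp _ _ _ _ _))).
by rewrite comp_idr comp_idl !iso_invK mmap_id comp_idl.
Qed.

(** Conjugation reverses [A ⊕ B], so contracting the right summand on one side
    is contracting the left one on the other; [conj_dL] matches the distributors
    used by the two contractions. *)
Lemma transpose_contrR (A B Z : X) (q : hom (B ⊗ K Z) ⊥) :
  (cjeps K Z)^-1 ⊗₁ 𝟙 ≫ chiT K (K Z) (A ⊕ B) ≫ fmap K (contrR A q)
  = 𝟙 ⊗₁ chiP K A B ≫ contrL (K A) (transpose q).
Proof.
rewrite /transpose contrL_natl; move: (conj_bot K) (conj_bot_left_inv K A) => b eb.
rewrite (ra (mmap_swap _ _ _)) !comp_assoc.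
congr (_ ≫ _); rewrite /contrL !mmap_compl !comp_assoc (ra3 (conj_dL _ _ _ _)) !comp_assoc.
rewrite -(fmap_id K) (ra (chiP_nat _ _ _)) fmap_id !comp_assoc eb.
by rewrite /contrR !fmap_comp.
Qed.

(** The outer evaluations agree by associativity of [χ_⊗], the inner ones by
    [transpose_contrR]. *)
Lemma transpose_par_pairing (A B Y Z : X) (p : hom (A ⊗ K Y) ⊥)
    (q : hom (B ⊗ K Z) ⊥) :
  transpose (𝟙 ⊗₁ (chiT K Z Y)^-1 ≫ par_pairing p q)
  = 𝟙 ⊗₁ chiP K A B ≫ tensor_pairing (transpose p) (transpose q).
Proof.
rewrite /tensor_pairing -(mmap_id tensor Y Z) (ra (massoc_nat _ _ _ _)) !comp_assoc.
rewrite (ra (esym (mmap_compr _ _ _ _))) -transpose_contrR.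
rewrite /transpose /par_pairing.
move: (contrR A q) (conj_bot K) => cq b.
have ee : (cjeps K (Y ⊗ Z))^-1 ≫ fmap K (chiT K Z Y)^-1
    = (cjeps K Y)^-1 ⊗₁ (cjeps K Z)^-1 ≫ chiT K (K Y) (K Z).
  have one : fmap K (chiT K Z Y) ≫ cjeps K (Y ⊗ Z) ≫ (cjeps K (Y ⊗ Z))^-1
      ≫ fmap K (chiT K Z Y)^-1 = 𝟙.
    by rewrite (ra (iso_morK _)) comp_idl -fmap_comp iso_morK fmap_id.
  rewrite -[X in _ = _ ≫ X]comp_idr -one.
  rewrite (ra3 (chi_eps (chiT_monoidal K) _ _)) (ra (esym (mmap_comp _ _ _ _ _))).
  by rewrite !iso_invK mmap_id comp_idl.
rewrite !fmap_comp !comp_assoc.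
rewrite (ra (esym (chi_natl (chiT_monoidal K) _ _))) !comp_assoc.
rewrite (ra (esym (mmap_compl _ _ _ _))) ee mmap_compl !comp_assoc.
rewrite (ra3 (esym (chi_assoc (chiT_monoidal K) _ _ _))) !comp_assoc.
rewrite (ra (massoc_nat _ _ _ _)) !comp_assoc !mmap_compr !comp_assoc.
rewrite (ra (esym (chi_natr (chiT_monoidal K) _ _))) !comp_assoc.
by rewrite !(ra (esym (mmap_comp _ _ _ _ _))) !comp_idl !comp_idr.
Qed.

(** The mirror image of [transpose_par_pairing], obtained from it because
    transposition is an involution. *)
Lemma transpose_tensor_pairing (A B Y Z : X) (p : hom (A ⊗ K Y) ⊥)
    (q : hom (B ⊗ K Z) ⊥) :
  transpose (𝟙 ⊗₁ chiP K Y Z ≫ tensor_pairing p q)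
  = 𝟙 ⊗₁ (chiT K B A)^-1 ≫ par_pairing (transpose p) (transpose q).
Proof.
by rewrite -[RHS]transposeK transpose_par_pairing !transposeK.
Qed.

Lemma transpose_unit :
  transpose (𝟙 ⊗₁ (conj_top K)^-1 ≫ uRT ⊥) = 𝟙 ⊗₁ (conj_bot K)^-1 ≫ uLT ⊥.
Proof.
rewrite mlunit_nat /transpose fmap_comp !comp_assoc.
rewrite (ra (esym (chi_natl (chiT_monoidal K) _ _))) !comp_assoc.
move: (conj_top K) (conj_top_left K ⊥) (conj_top_involutive K) => t left_unit tt.
have te : (cjeps K ⊤)^-1 ≫ fmap K t^-1 = t.
  by apply: (iso_mono (i := iso_sym t)); rewrite /= comp_assoc tt iso_invK iso_morK.
rewrite (ra (esym (mmap_compl _ _ _ _))) te (ra left_unit) !comp_assoc.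
by rewrite (ra (esym (fmap_comp _ _ _))) iso_invK fmap_id comp_idl.
Qed.

End Transpose.

(** * The dagger represented by sesquilinear pairings *)

Section ConjugateDual.
(** [dg A] stands for [A†]; the double conjugate in [K (K (L A))] is kept out of the
    calculations by asking only that [K (dg A)] be left dual to [A]. *)
Variables (X : LDC) (K : conjugation X) (dg : X -> X).
Variable du : forall A : X, linear_dual (K (dg A)) A.
Local Notation ev A := (eps (du A)).

(** It is locked so that rewriting with functoriality of [K] treats the maps
    represented by pairings as atoms; [conj_represent] is all that is used of it. *)
Definition represent (A Y : X) (p : hom (A ⊗ K Y) ⊥) : hom Y (dg A) :=
  locked ((cjeps K Y)^-1 ≫ fmap K (mate (du A) p) ≫ cjeps K (dg A)).

Lemma conj_unfold (Y Z : X) (m : hom (K Y) (K Z)) :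
  fmap K ((cjeps K Y)^-1 ≫ fmap K m ≫ cjeps K Z) = m.
Proof.
rewrite !fmap_comp cjeps_inv_conj cjeps_conj cjeps_nat (ra (iso_invK _)).
exact: comp_idl.
Qed.

Lemma conj_represent (A Y : X) (p : hom (A ⊗ K Y) ⊥) :
  fmap K (represent p) = mate (du A) p.
Proof. by rewrite /represent -lock conj_unfold. Qed.

Lemma represent_ev (A Y : X) (p : hom (A ⊗ K Y) ⊥) :
  𝟙 ⊗₁ fmap K (represent p) ≫ ev A = p.
Proof. by rewrite conj_represent mate_eps. Qed.

Lemma represent_inj (A Y : X) (f g : hom Y (dg A)) :
  𝟙 ⊗₁ fmap K f ≫ ev A = 𝟙 ⊗₁ fmap K g ≫ ev A -> f = g.
Proof. by move=> h; apply: (conj_faithful (K := K)); apply: (mate_inj (d := du A)). Qed.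

Section RepresentIso.
Variables (A Y : X) (d : linear_dual (K Y) A).

Definition represent_inv : hom (dg A) Y :=
  (cjeps K (dg A))^-1 ≫ fmap K (mate d (ev A)) ≫ cjeps K Y.

Lemma representK : represent (eps d) ≫ represent_inv = 𝟙.
Proof.
apply: (conj_faithful (K := K)); rewrite fmap_comp conj_represent conj_unfold fmap_id.
by apply: (mate_inj (d := d)); rewrite mmap_compr comp_assoc !mate_eps mmap_id comp_idl.
Qed.

Lemma represent_invK : represent_inv ≫ represent (eps d) = 𝟙.
Proof.
apply: (conj_faithful (K := K)); rewrite fmap_comp conj_represent conj_unfold fmap_id.
apply: (mate_inj (d := du A)).
by rewrite mmap_compr comp_assoc !mate_eps mmap_id comp_idl.
Qed.

Definition represent_iso : iso Y (dg A) := Iso representK represent_invK.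

Lemma represent_iso_ev : 𝟙 ⊗₁ fmap K represent_iso ≫ ev A = eps d.
Proof. exact: represent_ev. Qed.
End RepresentIso.

Definition dag_map (A B : X) (f : hom A B) : hom (dg B) (dg A) :=
  represent (f ⊗₁ 𝟙 ≫ ev B).

Lemma dag_map_ev (A B : X) (f : hom A B) :
  𝟙 ⊗₁ fmap K (dag_map f) ≫ ev A = f ⊗₁ 𝟙 ≫ ev B.
Proof. exact: represent_ev. Qed.

Lemma dag_map_id (A : X) : dag_map (idm A) = 𝟙.
Proof. by apply: represent_inj; rewrite dag_map_ev fmap_id. Qed.

Lemma dag_map_comp (A B D : X) (f : hom A B) (g : hom B D) :
  dag_map (f ≫ g) = dag_map g ≫ dag_map f.
Proof.
apply: represent_inj; rewrite dag_map_ev fmap_comp mmap_compr comp_assoc dag_map_ev.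
by rewrite (ra (mmap_swap _ _ _)) comp_assoc dag_map_ev mmap_compl comp_assoc.
Qed.

Definition dag_functor : functor (op X) X :=
  @Functor (op X) X dg (fun A B f => dag_map f) dag_map_id
    (fun A B D f g => dag_map_comp g f).

(** Each structure isomorphism comes from a left dual of the object whose dagger is
    its target: nested duals for [λ_⊗] and [λ_⊕], the mutual duality of the two units
    for [λ_⊤] and [λ_⊥], and the conjugate of the dual of [A] for [ι]. *)
Definition lamT_iso (A B : X) : iso (dg A ⊗ dg B) (dg (A ⊕ B)) :=
  represent_iso (dual_transport (tensor_par_dual (du B) (du A))
    (iso_sym (chiT K (dg B) (dg A))) (idiso (A ⊕ B))).

Definition lamP_iso (A B : X) : iso (dg A ⊕ dg B) (dg (A ⊗ B)) :=
  represent_iso (dual_transport (par_tensor_dual (du A) (du B))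
    (chiP K (dg A) (dg B)) (idiso (A ⊗ B))).

Definition lamtop_iso : iso ⊤ (dg ⊥) :=
  represent_iso (dual_transport (dual_top_bot X) (iso_sym (conj_top K)) (idiso ⊥)).

Definition lambot_iso : iso ⊥ (dg ⊤) :=
  represent_iso (dual_transport (dual_bot_top X) (iso_sym (conj_bot K)) (idiso ⊤)).

Definition iota_iso (A : X) : iso A (dg (dg A)) :=
  represent_iso (dual_transport (conj_dual K (du A)) (idiso (K A))
    (iso_sym (cjeps K (dg A)))).

(** The counit of the transported dual is the intended pairing by computation. *)
Lemma lamT_ev (A B : X) :
  𝟙 ⊗₁ fmap K (lamT_iso A B) ≫ ev (A ⊕ B)
  = 𝟙 ⊗₁ (chiT K (dg B) (dg A))^-1 ≫ par_pairing (ev A) (ev B).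
Proof. exact: represent_iso_ev. Qed.

Lemma lamP_ev (A B : X) :
  𝟙 ⊗₁ fmap K (lamP_iso A B) ≫ ev (A ⊗ B)
  = 𝟙 ⊗₁ chiP K (dg A) (dg B) ≫ tensor_pairing (ev A) (ev B).
Proof. exact: represent_iso_ev. Qed.

Lemma lamtop_ev :
  𝟙 ⊗₁ fmap K lamtop_iso ≫ ev ⊥ = 𝟙 ⊗₁ (conj_top K)^-1 ≫ uRT ⊥.
Proof. exact: represent_iso_ev. Qed.

Lemma lambot_ev :
  𝟙 ⊗₁ fmap K lambot_iso ≫ ev ⊤ = 𝟙 ⊗₁ (conj_bot K)^-1 ≫ uLT ⊥.
Proof. exact: represent_iso_ev. Qed.

Lemma iota_ev (A : X) :
  𝟙 ⊗₁ fmap K (iota_iso A) ≫ ev (dg A) = transpose (ev A).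
Proof. exact: represent_iso_ev. Qed.

Lemma ev_comp (A Y Z : X) (f : hom Z Y) (g : hom Y (dg A)) :
  𝟙 ⊗₁ fmap K (f ≫ g) ≫ ev A = 𝟙 ⊗₁ fmap K f ≫ 𝟙 ⊗₁ fmap K g ≫ ev A.
Proof. by rewrite fmap_comp mmap_compr comp_assoc. Qed.

(** The pairings of composites with the structure maps; in this form the axioms are
    checked without mentioning maps into [dg A] any more. *)
Lemma ev_dag_map (A B Y : X) (f : hom A B) (g : hom Y (dg B)) :
  𝟙 ⊗₁ fmap K (g ≫ dag_map f) ≫ ev A = f ⊗₁ 𝟙 ≫ 𝟙 ⊗₁ fmap K g ≫ ev B.
Proof. by rewrite ev_comp dag_map_ev (ra (mmap_swap _ _ _)) comp_assoc. Qed.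

Lemma ev_lamT (A B Y Z : X) (f : hom Y (dg A)) (g : hom Z (dg B)) :
  𝟙 ⊗₁ fmap K (f ⊗₁ g ≫ lamT_iso A B) ≫ ev (A ⊕ B)
  = 𝟙 ⊗₁ (chiT K Z Y)^-1
      ≫ par_pairing (𝟙 ⊗₁ fmap K f ≫ ev A) (𝟙 ⊗₁ fmap K g ≫ ev B).
Proof.
rewrite ev_comp lamT_ev (ra (esym (mmap_compr _ _ _ _))) chiT_inv_nat.
rewrite mmap_compr comp_assoc.
by rewrite -(mmap_id par A B) par_pairing_nat.
Qed.

Lemma ev_lamP (A B Y Z : X) (f : hom Y (dg A)) (g : hom Z (dg B)) :
  𝟙 ⊗₁ fmap K (f ⊕₁ g ≫ lamP_iso A B) ≫ ev (A ⊗ B)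
  = 𝟙 ⊗₁ chiP K Y Z
      ≫ tensor_pairing (𝟙 ⊗₁ fmap K f ≫ ev A) (𝟙 ⊗₁ fmap K g ≫ ev B).
Proof.
rewrite ev_comp lamP_ev (ra (esym (mmap_compr _ _ _ _))) -chiP_nat.
rewrite mmap_compr comp_assoc.
by rewrite -(mmap_id tensor A B) tensor_pairing_nat.
Qed.

Lemma ev_iota (A Y : X) (f : hom Y (dg A)) :
  𝟙 ⊗₁ fmap K (iota_iso A ≫ dag_map f) ≫ ev Y = transpose (𝟙 ⊗₁ fmap K f ≫ ev A).
Proof. by rewrite ev_dag_map iota_ev transpose_nat fmap_id. Qed.

Lemma lamT_iso_nat (A A' B B' : X) (f : hom A A') (g : hom B B') :
  dag_map f ⊗₁ dag_map g ≫ lamT_iso A B = lamT_iso A' B' ≫ dag_map (f ⊕₁ g).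
Proof.
apply: represent_inj; rewrite ev_lamT ev_dag_map lamT_ev !dag_map_ev.
rewrite (ra (esym (mmap_swap _ _ _))) comp_assoc -(mmap_id tensor (K (dg B'))).
by rewrite par_pairing_nat.
Qed.

Lemma lamP_iso_nat (A A' B B' : X) (f : hom A A') (g : hom B B') :
  dag_map f ⊕₁ dag_map g ≫ lamP_iso A B = lamP_iso A' B' ≫ dag_map (f ⊗₁ g).
Proof.
apply: represent_inj; rewrite ev_lamP ev_dag_map lamP_ev !dag_map_ev.
rewrite (ra (esym (mmap_swap _ _ _))) comp_assoc -(mmap_id par (K (dg B'))).
by rewrite tensor_pairing_nat.
Qed.

Lemma iota_iso_nat (A B : X) (f : hom A B) :
  f ≫ iota_iso B = iota_iso A ≫ dag_map (dag_map f).
Proof.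
apply: represent_inj; rewrite ev_iota dag_map_ev -(fmap_id K) transpose_nat.
by rewrite ev_comp iota_ev.
Qed.

Lemma lamT_iso_assoc (A B C : X) :
  𝟙 ⊗₁ lamT_iso B C ≫ lamT_iso A (B ⊕ C) ≫ dag_map (aP A B C)
  = (aT (dg A) (dg B) (dg C))^-1 ≫ lamT_iso A B ⊗₁ 𝟙 ≫ lamT_iso (A ⊕ B) C.
Proof.
apply: represent_inj; rewrite -[in LHS]comp_assoc ev_dag_map [in RHS]ev_comp !ev_lamT !lamT_ev.
rewrite !fmap_id !mmap_id !comp_idl.
rewrite par_pairing_natl par_pairing_natr -par_pairing_assoc.
rewrite (mmap_split tensor (aP A B C) (aT _ _ _)^-1) !comp_assoc.
rewrite !(ra (esym (mmap_compr _ _ _ _))) !comp_assoc (chi_assoc_inv (chiT_monoidal K)).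
by rewrite (ra (mmap_swap _ _ _)) comp_assoc.
Qed.

Lemma lamP_iso_assoc (A B C : X) :
  𝟙 ⊕₁ lamP_iso B C ≫ lamP_iso A (B ⊗ C) ≫ dag_map (aT A B C)
  = (aP (dg A) (dg B) (dg C))^-1 ≫ lamP_iso A B ⊕₁ 𝟙 ≫ lamP_iso (A ⊗ B) C.
Proof.
apply: represent_inj; rewrite -[in LHS]comp_assoc ev_dag_map [in RHS]ev_comp !ev_lamP !lamP_ev.
rewrite !fmap_id !mmap_id !comp_idl.
rewrite tensor_pairing_natl tensor_pairing_natr -tensor_pairing_assoc.
rewrite (mmap_split tensor (aT A B C) (aP _ _ _)^-1) !comp_assoc.
rewrite !(ra (esym (mmap_compr _ _ _ _))) !comp_assoc (chi_assoc_inv (chiP_monoidal K)).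
by rewrite (ra (mmap_swap _ _ _)) comp_assoc.
Qed.

Lemma lamT_iso_unitl (A : X) :
  lamtop_iso ⊗₁ 𝟙 ≫ lamT_iso ⊥ A = uLT (dg A) ≫ dag_map (uLP A).
Proof.
apply: represent_inj; rewrite ev_lamT ev_dag_map lamtop_ev fmap_id mmap_id comp_idl.
rewrite par_pairing_natl par_pairing_unitl.
rewrite (mmap_split tensor (uLP A) (uRT _)) !comp_assoc.
rewrite !(ra (esym (mmap_compr _ _ _ _))) !comp_assoc conj_top_right_inv.
by rewrite (ra (mmap_swap _ _ _)) comp_assoc.
Qed.

Lemma lamT_iso_unitr (A : X) :
  𝟙 ⊗₁ lamtop_iso ≫ lamT_iso A ⊥ = uRT (dg A) ≫ dag_map (uRP A).
Proof.
apply: represent_inj; rewrite ev_lamT ev_dag_map lamtop_ev fmap_id mmap_id comp_idl.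
rewrite par_pairing_natr par_pairing_unitr.
rewrite (mmap_split tensor (uRP A) (uLT _)) !comp_assoc.
rewrite !(ra (esym (mmap_compr _ _ _ _))) !comp_assoc conj_top_left_inv.
by rewrite (ra (mmap_swap _ _ _)) comp_assoc.
Qed.

Lemma lamP_iso_unitl (A : X) :
  lambot_iso ⊕₁ 𝟙 ≫ lamP_iso ⊤ A = uLP (dg A) ≫ dag_map (uLT A).
Proof.
apply: represent_inj; rewrite ev_lamP ev_dag_map lambot_ev fmap_id mmap_id comp_idl.
rewrite tensor_pairing_natl tensor_pairing_unitl.
rewrite (mmap_split tensor (uLT A) (uRP _)) !comp_assoc.
rewrite !(ra (esym (mmap_compr _ _ _ _))) !comp_assoc conj_bot_right_inv.
by rewrite (ra (mmap_swap _ _ _)) comp_assoc.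
Qed.

Lemma lamP_iso_unitr (A : X) :
  𝟙 ⊕₁ lambot_iso ≫ lamP_iso A ⊤ = uRP (dg A) ≫ dag_map (uRT A).
Proof.
apply: represent_inj; rewrite ev_lamP ev_dag_map lambot_ev fmap_id mmap_id comp_idl.
rewrite tensor_pairing_natr tensor_pairing_unitr.
rewrite (mmap_split tensor (uRT A) (uLP _)) !comp_assoc.
rewrite !(ra (esym (mmap_compr _ _ _ _))) !comp_assoc conj_bot_left_inv.
by rewrite (ra (mmap_swap _ _ _)) comp_assoc.
Qed.

Lemma dag_iso_dL (A B C : X) :
  dL (dg A) (dg B) (dg C) ≫ lamT_iso A B ⊕₁ 𝟙 ≫ lamP_iso (A ⊕ B) C
  = 𝟙 ⊗₁ lamP_iso B C ≫ lamT_iso A (B ⊗ C) ≫ dag_map (dR C A B).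
Proof.
apply: represent_inj; rewrite -[in RHS]comp_assoc ev_dag_map [in LHS]ev_comp ev_lamP ev_lamT.
rewrite lamP_ev lamT_ev !fmap_id !mmap_id !comp_idl.
rewrite par_pairing_natr tensor_pairing_natl.
rewrite !(ra (esym (mmap_compr _ _ _ _))) !comp_assoc conj_dR_inv.
rewrite (ra (esym (mmap_swap _ _ _))) !comp_assoc -dR_pairing.
by rewrite !mmap_compr !comp_assoc.
Qed.

Lemma dag_iso_dR (A B C : X) :
  dR (dg A) (dg B) (dg C) ≫ 𝟙 ⊕₁ lamT_iso C A ≫ lamP_iso B (C ⊕ A)
  = lamP_iso B C ⊗₁ 𝟙 ≫ lamT_iso (B ⊗ C) A ≫ dag_map (dL B C A).
Proof.
apply: represent_inj; rewrite -[in RHS]comp_assoc ev_dag_map [in LHS]ev_comp ev_lamP ev_lamT.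
rewrite lamP_ev lamT_ev !fmap_id !mmap_id !comp_idl.
rewrite par_pairing_natl tensor_pairing_natr.
rewrite !(ra (esym (mmap_compr _ _ _ _))) !comp_assoc conj_dL_inv.
rewrite (ra (esym (mmap_swap _ _ _))) !comp_assoc -dL_pairing.
by rewrite !mmap_compr !comp_assoc.
Qed.

Lemma iota_iso_par (A B : X) :
  iota_iso (A ⊕ B) ≫ dag_map (lamT_iso A B)
  = iota_iso A ⊕₁ iota_iso B ≫ lamP_iso (dg A) (dg B).
Proof.
apply: represent_inj; rewrite ev_iota lamT_ev transpose_par_pairing.
by rewrite ev_lamP !iota_ev.
Qed.

Lemma iota_iso_tensor (A B : X) :
  iota_iso (A ⊗ B) ≫ dag_map (lamP_iso A B)
  = iota_iso A ⊗₁ iota_iso B ≫ lamT_iso (dg A) (dg B).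
Proof.
apply: represent_inj; rewrite ev_iota lamP_ev transpose_tensor_pairing.
by rewrite ev_lamT !iota_ev.
Qed.

Lemma iota_iso_bot : iota_iso ⊥ ≫ dag_map lamtop_iso = lambot_iso.
Proof.
by apply: represent_inj; rewrite ev_iota lamtop_ev transpose_unit lambot_ev.
Qed.

Lemma iota_iso_top : iota_iso ⊤ ≫ dag_map lambot_iso = lamtop_iso.
Proof.
apply: represent_inj; rewrite ev_iota lambot_ev lamtop_ev.
by rewrite -transpose_unit transposeK.
Qed.

(** [ι_(A†)] is inverse to [(ι_A)†] because [ev_A^tt = ev_A]. *)
Lemma iota_iso_dag (A : X) : iso_mor (iota_iso (dg A)) = dag_map (iota_iso A)^-1.
Proof.
have h : iota_iso (dg A) ≫ dag_map (iota_iso A) = 𝟙.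
  apply: represent_inj; rewrite ev_iota iota_ev transposeK.
  by rewrite fmap_id mmap_id comp_idl.
rewrite -[LHS]comp_idr -dag_map_id -(iso_invK (iota_iso A)) dag_map_comp.
by rewrite (ra h) comp_idl.
Qed.

Definition conj_dagger : dagger X :=
  @Dagger X dag_functor lamT_iso lamP_iso lamtop_iso lambot_iso iota_iso
    lamT_iso_nat lamP_iso_nat iota_iso_nat lamT_iso_assoc lamP_iso_assoc
    lamT_iso_unitl lamT_iso_unitr lamP_iso_unitl lamP_iso_unitr
    dag_iso_dL dag_iso_dR iota_iso_par iota_iso_tensor
    iota_iso_bot iota_iso_top iota_iso_dag.

End ConjugateDual.

Theorem theorem4p12 (X : LDC) (C : conjugative_cyclic_star_autonomous X) :
  exists D : dagger_star_autonomous X, dsa_star D = ccs_star C.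
Proof.
pose K := ccs_conj C.
(* Pairings are against objects [K Y], so the dual of [A] must be put in the form
   [K _] before it can represent them. *)
pose du (A : X) : linear_dual (K (K (lstar (ccs_star C) A))) A :=
  dual_transport (lstar_dual (ccs_star C) A) (cjeps K _) (idiso A).
by exists (DaggerStarAut (ccs_star C) (conj_dagger du)).
Qed.
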